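(* For any $\epsilon, C > 0$, any integer $k \ge 5$, and any nonzero integers $a_1,\ldots,a_k$ with $a_1 + \cdots + a_k = 0$, there exists $\delta > 0$ such that the following holds. Let $n \ge 1$ be an integer and let $S \subset \{1,\ldots,n\}$ satisfy (i) $|S| \ge \epsilon n^{1/2}$, (ii) for each integer $h \ne 0$, $S$ contains at most $C$ pairs of the form $(x, x+h)$ (i.e. there are at most $C$ elements $x\in S$ with $x+h\in S$). Then $S$ contains at least $\delta |S|^k/n$ solutions $(x_1,\ldots,x_k)\in S^k$ to the linear equation $a_1x_1 + \cdots + a_kx_k = 0$. *)

(* Defs.v *)
From mathcomp Require Import all_boot all_order all_algebra.
From mathcomp Require Import finmap.
From mathcomp Require Import reals.

Set Implicit Arguments.
Unset Strict Implicit.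
Unset Printing Implicit Defensive.

Import Order.TTheory GRing.Theory Num.Theory.

Local Open Scope fset_scope.
Local Open Scope ring_scope.

Definition pairs_at_distance (S : {fset int}) (h : int) : {fset int} :=
  [fset x in S | x + h \in S].

(* All solutions in S^k are counted, including degenerate ones with repeated
   coordinates. *)
Definition solutions (k : nat) (a : 'I_k -> int) (S : {fset int}) :
    {set {ffun 'I_k -> S}} :=
  [set x : {ffun 'I_k -> S} | \sum_(i < k) a i * val (x i) == 0].

(* Main.v *)
(** Reduce modulo [N = L! n + 1], where [L = sum |a_i|]: this [N] is comparable to [n],
    creates no new solutions, and makes every nonzero integer of size at most [L]
    invertible.

    Write [f] for the indicator function of [S]. The bound on differences makes the
    additive energy [O(|S|^2)], so [f] has bounded (normalized) Fourier [l^4] norm and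
    few large Fourier coefficients. By pigeonhole there is a set [D] of positive density
    on which all the corresponding characters are nearly constant. Replacing [f] by its
    average [F] over the translates by [D] changes the count of solutions by a small
    multiple of [|S|^k / N] because [k >= 5]: four of the factors are absorbed by the
    [l^4] norm and one is small in sup norm.

    The bound on differences also bounds [F] in [l^2], by a constant that does not depend
    on [D], so [F >= |S| / (2 N)] on a set of density bounded below. It remains to count
    the solutions inside a dense set. For three variables this is Roth's theorem, proved
    by Szemerédi's cube argument, together with Varnavides averaging. For more variables
    one merges two of the coefficients and inducts; listing the positive coefficients
    first keeps all partial sums nonzero. *)
Require Import Defs.
From mathcomp Require Import all_boot all_order all_algebra.
From mathcomp Require Import cyclic separable cyclotomic.
From mathcomp Require Import finmap.
From mathcomp Require Import reals.
From mathcomp Require Import complex.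
From mathcomp Require Import zify lra ring.

Set Implicit Arguments.
Unset Strict Implicit.
Unset Printing Implicit Defensive.

Import Order.TTheory GRing.Theory Num.Theory.

Local Open Scope fset_scope.
Local Open Scope ring_scope.

(** * Three-point patterns in dense sets of integers *)

Definition cnt (A : pred nat) (f l : nat) : nat := (\sum_(i < l) A (f + i)%N)%N.

Lemma cntD A f l m : cnt A f (l + m) = (cnt A f l + cnt A (f + l) m)%N.
Proof.
rewrite /cnt big_split_ord /=; congr addn.
by apply: eq_bigr => i _; rewrite addnA.
Qed.

Lemma cnt1 A f : cnt A f 1 = A f.
Proof. by rewrite /cnt big_ord1 addn0. Qed.

Lemma cnt_le A f l : (cnt A f l <= l)%N.
Proof.
apply: (@leq_trans (\sum_(i < l) 1)%N); last by rewrite sum_nat_const card_ord muln1.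
by apply: leq_sum => i _; exact: leq_b1.
Qed.

Lemma leq_cnt (A B : pred nat) f l :
  (forall x, A x -> B x) -> (cnt A f l <= cnt B f l)%N.
Proof.
move=> AB; apply: leq_sum => i _.
by case: (boolP (A _)) => // /AB ->.
Qed.

Lemma cnt_shift A f l t :
  (cnt A (f + t) l <= cnt A f l + t)%N /\ (cnt A f l <= cnt A (f + t) l + t)%N.
Proof.
have e : (cnt A f t + cnt A (f + t) l = cnt A f l + cnt A (f + l) t)%N.
  by rewrite -!cntD addnC.
have := cnt_le A f t; have := cnt_le A (f + l) t; lia.
Qed.

Lemma cnt_shiftE A f g l : cnt (fun x => A (x + g)%N) f l = cnt A (f + g) l.
Proof. by apply: eq_bigr => i _; rewrite addnAC. Qed.

Lemma cnt_gt0 A f l : (0 < cnt A f l)%N -> exists2 x, (f <= x < f + l)%N & A x.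
Proof.
elim: l => [|l IH]; first by rewrite /cnt big_ord0.
rewrite -[l.+1]addn1 cntD cnt1; case: (boolP (A (f + l)%N)) => [h _|_].
  by exists (f + l)%N => //; lia.
rewrite addn0 => /IH[x hx Ax]; exists x => //; lia.
Qed.

(* A set of density > 1/T cannot have T almost disjoint translates. *)
Lemma dense_overlap (p T D x : nat) (B : pred nat) (rho : nat) :
  (forall h, (0 < h < T)%N -> cnt (fun y => B y && B (y + p * h)%N) x D <= rho)%N ->
  (T * cnt B x D <= D + T ^ 2 * (rho + p * T) + p * T ^ 2)%N.
Proof.
move=> hr.
pose m y := (\sum_(t < T) B (y + p * t))%N.
(* If [t1] is the least index with [y + p * t1] in [B], the pairs [(t1, s)] already account for
   every other index hit. *)
have hm y : (m y <= 1 + \sum_(t < T) \sum_(s < T)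
     ((t < s) && (B (y + p * t) && B (y + p * s))))%N.
  rewrite /m; have [/existsP[t0 ht0]|no] := boolP [exists t : 'I_T, B (y + p * t)%N]; last first.
    rewrite big1 // => t _; apply/eqP; rewrite eqb0.
    by move: no; rewrite negb_exists => /forallP.
  case: (@arg_minnP _ t0 (fun t : 'I_T => B (y + p * t)%N) (@nat_of_ord T) ht0) => t1 ht1 hmin.
  rewrite (bigD1 t1) //= ht1 leq_add2l.
  rewrite [leqRHS](bigD1 t1) //=; apply: leq_trans (leq_addr _ _).
  rewrite [leqRHS](bigD1 t1) //=; apply: leq_trans (leq_addl _ _).
  apply: leq_sum => s hs; case: (boolP (B (y + p * s)%N)) => // hB.
  rewrite ht1 ltn_neqAle (hmin s hB) !andbT.
  by rewrite eq_sym -(inj_eq val_inj) /= in hs *; rewrite hs.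
have h1 : (\sum_(i < D) m (x + i)%N <= D + T ^ 2 * (rho + p * T))%N.
  apply: leq_trans; first by apply: leq_sum => i _; exact: hm.
  rewrite big_split /= sum_nat_const card_ord muln1 leq_add2l exchange_big /=.
  apply: (@leq_trans (\sum_(t < T) \sum_(s < T) (rho + p * T))).
    apply: leq_sum => t _; rewrite exchange_big /=; apply: leq_sum => s _.
    case: (ltnP t s) => ts; last by rewrite big1.
    have hs := ltn_ord s.
    have := hr (s - t)%N; rewrite /= => /(_ ltac:(lia)) h.
    have [hA _] := cnt_shift (fun y => B y && B (y + p * (s - t))%N) x D (p * t).
    rewrite -cnt_shiftE in hA.
    apply: leq_trans (leq_trans hA _); last first.
      apply: leq_add => //; apply: leq_mul => //; lia.
    apply: leq_sum => i _; rewrite -(addnA (x + i)%N (p * t)%N) -mulnDr subnKC //.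
    exact: ltnW.
  by rewrite !sum_nat_const !card_ord -mulnn mulnA.
have h2 : (T * cnt B x D <= \sum_(i < D) m (x + i) + p * T ^ 2)%N.
  rewrite exchange_big /=.
  have -> : (T * cnt B x D = \sum_(t < T) cnt B x D)%N by rewrite sum_nat_const card_ord.
  have -> : (p * T ^ 2 = \sum_(t < T) p * T)%N.
    by rewrite sum_nat_const card_ord -mulnn mulnCA.
  rewrite -big_split /=; apply: leq_sum => t _.
  have [_ hB] := cnt_shift B x D (p * t).
  rewrite -cnt_shiftE in hB; apply: (leq_trans hB); rewrite leq_add2l leq_mul2l.
  by rewrite (ltnW (ltn_ord t)) orbT.
by move: h1 h2; lia.
Qed.

(** The vertices, relative to the base point, of the Hilbert cube with sides [js]; the empty sum 0
    always occurs. *)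
Fixpoint subset_sums (js : seq nat) : seq nat :=
  if js is j :: js' then subset_sums js' ++ [seq s + j | s <- subset_sums js']%N
  else [:: 0%N].

Lemma archi (K : archiRealFieldType) (x : K) : exists n : nat, x <= n%:R.
Proof.
exists (Num.bound `|x|).
exact: le_trans (ler_norm x) (ltW (archi_boundP (normr_ge0 x))).
Qed.

(** Hilbert's cube lemma. By [dense_overlap] some translate of [B] by [p * h] meets [B] in positive
    density; a cube inside the intersection, with [h] as an extra side, gives a cube of one more
    dimension inside [B]. The bounds [H] and [D0] are uniform in [x] and [B]. *)
Lemma cube_lemma (K : archiRealFieldType) (p k : nat) (beta : K) : 0 < beta ->
  exists H D0 : nat, forall (D x : nat) (B : pred nat), (D0 <= D)%N ->
    beta * D%:R <= (cnt B x D)%:R ->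
    exists w js, [/\ (x <= w < x + D)%N, size js = k,
      all (fun j => 0 < j <= H)%N js &
      forall s, s \in subset_sums js -> B (w + p * s)%N].
Proof.
elim: k beta => [|k IH] beta b0.
  exists 0%N, 1%N => D x B D1 hB.
  have /cnt_gt0[w hw Bw] : (0 < cnt B x D)%N.
    by rewrite -(ltr0n K); apply: lt_le_trans hB; rewrite mulr_gt0 // ltr0n.
  by exists w, [::]; split=> // s; rewrite inE => /eqP->; rewrite muln0 addn0.
have [T hT] := archi (2 / beta).
have T2 : 2 <= T%:R * beta by rewrite -ler_pdivrMr.
have T0 : 0 < T%:R :> K by apply: lt_le_trans hT; rewrite divr_gt0.
have r0 : 0 < 1 / (4 * T%:R ^+ 2) :> K.
  by apply: divr_gt0 => //; apply: mulr_gt0 => //; apply: exprn_gt0.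
have [H [D1 hH]] := IH _ r0.
exists (maxn H T), (maxn D1 (2 * (p * T ^ 2 + T ^ 2 * (p * T)) + 1))%N => D x B hD hB.
have [/existsP[h /andP[h0 hh]]|no] := boolP [exists h : 'I_T, (0 < h)%N &&
    (1 / (4 * T%:R ^+ 2) * D%:R <= (cnt (fun y => B y && B (y + p * h)%N) x D)%:R :> K)].
  have [w [js [hw sz hjs hcube]]] := hH D x _ ltac:(lia) hh.
  exists w, (nat_of_ord h :: js); split=> //=; first by rewrite sz.
    rewrite h0 /=; apply/andP; split; first by have := ltn_ord h; lia.
    by apply: sub_all hjs => j /andP[-> /=]; rewrite leq_max => ->.
  move=> s; rewrite mem_cat => /orP[/hcube/andP[]//|/mapP[s' /hcube/andP[_ hB'] ->]].
  by rewrite mulnDr addnA.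
exfalso.
(* If every overlap had fewer than D / (4 T^2) points, [dense_overlap] would give 2 D <= D + D / 4 +
   O(1), where the O(1) is below D / 2 by the choice of [D0]. *)
pose rho := (D %/ (4 * T ^ 2))%N.
have hr h : (0 < h < T)%N -> (cnt (fun y => B y && B (y + p * h)%N) x D <= rho)%N.
  case/andP=> h0 hlt; move: no; rewrite negb_exists => /forallP/(_ (Ordinal hlt)) /=.
  rewrite h0 /= -ltNge => hc; rewrite /rho leq_divRL; last first.
    by move: T0; rewrite ltr0n muln_gt0 expn_gt0 => ->.
  rewrite -(ler_nat K) natrM natrM natrX.
  rewrite -ler_pdivlMr ?mulr_gt0 ?exprn_gt0 //.
  by move: hc; rewrite div1r mulrC => /ltW.
have := dense_overlap hr.
rewrite -(ler_nat K) !(natrD, natrM) => hov.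
have h1 : 2 * D%:R <= T%:R * (cnt B x D)%:R :> K.
  apply: le_trans (ler_wpM2l (ltW T0) hB); rewrite mulrA ler_wpM2r ?ler0n //.
have h2 : T%:R * T%:R * rho%:R <= D%:R / 4 :> K.
  rewrite ler_pdivlMr // -!natrM ler_nat /rho mulnn.
  by have := leq_divM D (4 * T ^ 2); clear; lia.
have h3 : 2 * (p%:R * (T%:R * T%:R) + T%:R * T%:R * (p%:R * T%:R)) + 1 <= D%:R :> K.
  by rewrite -!natrM -!natrD -natrM natr1 ler_nat mulnn; clear -hD; lia.
rewrite mulrDr in hov; set a := _ * (p%:R * _) in hov h3; set b := p%:R * _ in hov h3.
by have D0 : 0 <= D%:R :> K := ler0n _ D; lra.
Qed.

(** The patterns u = y, v = y + p d, w = y + (p + q) d solve q u + p w = (p + q) v; this is the link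
    with three-term equations. *)
Definition pattern_free (p q : nat) (A : pred nat) : Prop :=
  forall y d, (0 < d)%N -> A y -> A (y + p * d)%N -> ~~ A (y + (p + q) * d)%N.

Definition roth_bound (K : archiRealFieldType) (p q : nat) (alpha : K) : Prop :=
  exists2 M : nat, (0 < M)%N &
    forall A, pattern_free p q A -> (cnt A 0 M)%:R <= alpha * M%:R.

Lemma pattern_free_affine p q A f g : (0 < g)%N ->
  pattern_free p q A -> pattern_free p q (fun i => A (f + g * i)%N).
Proof.
move=> g0 hA y d d0 h1 h2.
have := hA (f + g * y)%N (g * d)%N; rewrite muln_gt0 g0 d0 => /(_ isT h1).
by rewrite !mulnDr !addnA !(mulnCA _ g) in h2 *; apply.
Qed.

(** Blocks of length [L] tile the interval and inherit the bound by translation; the incomplete last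
    block costs at most [L]. *)
Lemma cnt_pattern_free_le (K : archiRealFieldType) p q (lam : K) L A f l : 0 <= lam -> (0 < L)%N ->
  (forall A, pattern_free p q A -> (cnt A 0 L)%:R <= lam * L%:R) ->
  pattern_free p q A -> (cnt A f l)%:R <= lam * l%:R + L%:R.
Proof.
move=> lam0 L0 hL hA.
have hm n : (cnt A f (n * L))%:R <= lam * (n * L)%:R.
  elim: n => [|n IH]; first by rewrite mul0n mulr0 /cnt big_ord0.
  rewrite mulSnr cntD !natrD mulrDr lerD //.
  have := hL _ (@pattern_free_affine p q A (f + n * L) 1 isT hA).
  congr (_ <= _); congr _%:R; apply: eq_bigr => i _; by rewrite add0n mul1n.
rewrite {1 2}(divn_eq l L) cntD !natrD mulrDr -addrA lerD //.
apply: (@le_trans _ _ L%:R); last by rewrite lerDr mulr_ge0 ?ler0n.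
by rewrite ler_nat (leq_trans (cnt_le _ _ _)) // ltnW // ltn_mod.
Qed.

Lemma cnt_residues A f p l :
  cnt A f (p * l) = (\sum_(r < p) cnt (fun i => A (f + r + p * i)) 0 l)%N.
Proof.
elim: l => [|l IH]; first by rewrite muln0 /cnt big_ord0 big1 // => r _; rewrite big_ord0.
rewrite mulnS addnC cntD IH {2}/cnt -big_split /=; apply: eq_bigr => r _.
by rewrite -[l.+1]addn1 cntD cnt1 add0n addnAC.
Qed.

Lemma cnt_dilate (U V : pred nat) (w q D : nat) : (0 < q)%N ->
  (forall d, (0 < d <= D)%N -> U d -> V (w + q * d)%N) ->
  (cnt U 1 D <= cnt V w (q * D + 1))%N.
Proof.
move=> q0; elim: D => [|D IH] hUV; first by rewrite /cnt big_ord0.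
rewrite -[D.+1]addn1 cntD cnt1 mulnDr muln1 addnAC cntD leq_add //.
  by apply: IH => d hd; apply: hUV; lia.
case: (boolP (U (1 + D)%N)) => // hU.
have hV : V (w + q * (1 + D))%N by apply: hUV => //; lia.
rewrite -[X in cnt V _ X](prednK q0) -[X in cnt V _ X]addn1.
rewrite cntD cnt1; have -> : (w + (q * D + 1) + q.-1 = w + q * (1 + D))%N by nia.
by rewrite hV leq_addl.
Qed.

Lemma cntC (V : pred nat) f l : (cnt V f l + cnt (fun x => ~~ V x) f l = l)%N.
Proof.
rewrite /cnt -big_split /= -[RHS]card_ord -sum1_card; apply: eq_bigr => i _.
by case: (V _).
Qed.

(* If [V] misses [A] and is almost invariant under translation by [g], then most
   [g]-progressions of length [L] starting in [V] stay in [V], hence miss [A]. *)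
Lemma almost_invariant_cnt (K : archiRealFieldType) (A V : pred nat) (L g w l z : nat) (lam : K) :
  (forall x, V x -> ~~ A x) ->
  (forall f, (cnt (fun i => A (f + g * i)%N) 0 L)%:R <= lam * L%:R) ->
  (cnt (fun x => V x && ~~ V (x + g)%N) w l <= z)%N ->
  L%:R * (cnt A w l)%:R <= lam * L%:R * (l%:R - (cnt V w l)%:R)
     + (L * (L * (z + g * L)) + L * (g * L))%:R.
Proof.
set Y := (fun x => V x && _); move=> VA hlam hz.
(* Moving the window by g i with i < L costs at most g L points, so the count of [A] can be taken
   along progressions of step [g]. *)
have h1 : (L * cnt A w l <= \sum_(i < L) cnt A (w + g * i) l + L * (g * L))%N.
  have -> : (L * cnt A w l = \sum_(i < L) cnt A w l)%N by rewrite sum_nat_const card_ord.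
  have -> : (L * (g * L) = \sum_(i < L) g * L)%N by rewrite sum_nat_const card_ord.
  rewrite -big_split /=; apply: leq_sum => i _.
  have [_ h] := cnt_shift A w l (g * i).
  by apply: (leq_trans h); rewrite leq_add2l leq_mul2l (ltnW (ltn_ord i)) orbT.
have h2 : (\sum_(i < L) cnt Y (w + g * i) l <= L * (z + g * L))%N.
  have -> : (L * (z + g * L) = \sum_(i < L) (z + g * L))%N by rewrite sum_nat_const card_ord.
  apply: leq_sum => i _; have [h _] := cnt_shift Y w l (g * i).
  by apply: (leq_trans h); rewrite leq_add // leq_mul2l (ltnW (ltn_ord i)) orbT.
(* Outside [V], use [hlam]. Inside [V], either the progression leaves [V] at some step and [Y] pays
   for all [L] terms, or it stays in [V] and misses [A]. *)
have hpt x : ((\sum_(i < L) A (x + g * i))%N)%:R <=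
   lam * L%:R * (~~ V x)%:R + (L * \sum_(i < L) Y (x + g * i)%N)%:R.
  case: (boolP (V x)) => /= Vx; last first.
    rewrite mulr1; apply: le_trans (_ : lam * L%:R <= _); last by rewrite lerDl ler0n.
    exact: le_trans (hlam x).
  rewrite mulr0 add0r ler_nat.
  case: (posnP (\sum_(i < L) Y (x + g * i))%N) => [|s0]; last first.
    apply: leq_trans (leq_pmulr _ s0); apply: (@leq_trans (\sum_(i < L) 1)).
      by apply: leq_sum => i _; exact: leq_b1.
    by rewrite sum_nat_const card_ord muln1.
  move/eqP; rewrite sum_nat_eq0 => /forallP hY.
  have hV i : (i <= L)%N -> V (x + g * i)%N.
    elim: i => [|i IH] iL; first by rewrite muln0 addn0.
    have := hY (Ordinal iL); rewrite /= /Y IH ?(ltnW iL) //= eqb0 negbK.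
    by rewrite -addnA -mulnSr.
  rewrite big1 // => i _; apply/eqP; rewrite eqb0; apply: VA; apply: hV; exact: ltnW.
have h3 : (\sum_(i < L) cnt A (w + g * i) l)%:R <= lam * L%:R * (l%:R - (cnt V w l)%:R)
   + (L * \sum_(i < L) cnt Y (w + g * i) l)%:R.
  rewrite /cnt exchange_big /= [X in (L * X)%N]exchange_big /= big_distrr /=.
  have -> : l%:R - (\sum_(i < l) V (w + i)%N)%:R = \sum_(i < l) (~~ V (w + i)%N)%:R :> K.
    rewrite -natr_sum -[X in X%:R - _](cntC V w l) natrD addrC addKr //.
  rewrite mulr_sumr !natr_sum -big_split /=; apply: ler_sum => i _.
  have := hpt (w + i)%N.
  by under eq_bigr do rewrite addnAC; under [X in (_ * X)%N]eq_bigr do rewrite addnAC.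
rewrite -natrM; apply: le_trans (_ : (\sum_(i < L) cnt A (w + g * i) l + L * (g * L))%:R <= _).
  by rewrite ler_nat.
rewrite natrD; apply: (le_trans (lerD h3 (lexx _))).
rewrite natrD addrA lerD2r lerD2l ler_nat leq_mul2l h2 orbT //.
Qed.

(** If every side raised [F] by more than l / k, the increments would add up to the second
    alternative. That one is impossible when [F] is bounded by [l] and [size js = k] is positive. *)
Lemma slow_growth_suffix (F : seq nat -> nat) (l k : nat) (js : seq nat) :
  (exists s j s', js = s ++ j :: s' /\ k * F (j :: s') <= k * F s' + l)%N \/
  (size js * l + size js <= k * F js)%N.
Proof.
elim: js => [|j js [[s [i [s' [-> h]]]]|IH]]; first by right.
  by left; exists (j :: s), i, s'.
have [h|h] := leqP (k * F (j :: js)) (k * F js + l).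
  by left; exists [::], j, js.
by right => /=; lia.
Qed.

(* [u = w - p d], [w + p s] and [w + q d + (p + q) s] form a pattern with
   difference [d + s]. *)
Definition forbidden (p q D w : nat) (A : pred nat) (js : seq nat) : pred nat :=
  fun v => has (fun s => has (fun d => A (w - p * d)%N
     && (v == w + q * d + (p + q) * s)%N) (iota 1 D)) (subset_sums js).

Lemma forbiddenP p q D w A js v :
  pattern_free p q A -> (p * D <= w)%N ->
  (forall s, s \in subset_sums js -> A (w + p * s)%N) ->
  forbidden p q D w A js v -> ~~ A v.
Proof.
move=> hA hw hcube /hasP[s hs /hasP[d]]; rewrite mem_iota => hd /andP[Au /eqP->].
have pd : (p * d <= w)%N by apply: leq_trans hw; rewrite leq_mul2l; lia.
have := hA (w - p * d)%N (d + s)%N ltac:(lia) Au.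
have -> : (w - p * d + p * (d + s) = w + p * s)%N by rewrite mulnDr addnA subnK.
move=> /(_ (hcube _ hs)); congr (~~ A _).
by rewrite mulnDr [in LHS](mulnDl p q d) !addnA subnK.
Qed.

Lemma forbidden_suffix p q D w A s js v :
  forbidden p q D w A js v -> forbidden p q D w A (s ++ js) v.
Proof.
elim: s => //= j s IH h; rewrite /forbidden /= has_cat.
by rewrite [X in X || _](IH h).
Qed.

Lemma forbidden_shift p q D w A j js v :
  forbidden p q D w A js v -> forbidden p q D w A (j :: js) (v + (p + q) * j)%N.
Proof.
move=> /hasP[s hs /hasP[d hd /andP[h1 /eqP->]]].
apply/hasP; exists (s + j)%N => /=.
  by rewrite mem_cat; apply/orP; right; apply/mapP; exists s.
by apply/hasP; exists d => //; rewrite h1 /= mulnDr addnA.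
Qed.

(** The forbidden sets of the successive suffixes of [js] are nested, so within an interval of
    length q D + 1 some new side [j] adds at most a fraction 1 / k of it. The set [V] before that
    step is almost invariant under translation by (p + q) j, hence [A] has density at most about
    [lam] on the complement of [V]; and [V] has at least one point for each [d] with w - p d in
    [A]. *)
Lemma roth_step_cnt (K : archiRealFieldType) (p q D w L k H : nat)
    (A : pred nat) (lam : K) (js : seq nat) :
  (0 < p)%N -> (0 < q)%N -> (0 < k)%N ->
  pattern_free p q A -> (p * D <= w)%N -> size js = k -> 0 <= lam ->
  all (fun j => 0 < j <= H)%N js ->
  (forall s, s \in subset_sums js -> A (w + p * s)%N) ->
  (forall A, pattern_free p q A -> (cnt A 0 L)%:R <= lam * L%:R) -> (0 < L)%N ->
  (cnt A w (q * D + 1))%:R <=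
    lam * ((q * D + 1)%:R - (cnt (fun d => A (w - p * d)%N) 1 D)%:R)
    + (L * (q * D + 1))%:R / k%:R + (L * (L + 2) * ((p + q) * H))%:R.
Proof.
move=> p0 q0 k0 hA hw szjs lam0 hjs hcube hL L0.
set l := (q * D + 1)%N.
pose F s := cnt (forbidden p q D w A s) w l.
have [[s [j [s' [ejs hF]]]]|] := slow_growth_suffix F l k js; last first.
  by have := cnt_le (forbidden p q D w A js) w l; rewrite szjs -/(F js); nia.
set V := forbidden p q D w A s'.
have /andP[j0 jH] : (0 < j <= H)%N.
  by move: hjs; rewrite ejs all_cat /= => /and3P[].
set g := ((p + q) * j)%N.
have g0 : (0 < g)%N by rewrite /g muln_gt0 addn_gt0 p0 j0.
have gH : (g <= (p + q) * H)%N by rewrite leq_mul2l jH orbT.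
have VA x : V x -> ~~ A x.
  move=> hV; apply: (forbiddenP hA hw hcube).
  by rewrite ejs -cat1s catA; apply: forbidden_suffix; exact: hV.
pose Z := fun x => forbidden p q D w A (j :: s') x && ~~ V x.
have hZ : (k * cnt Z w l <= l)%N.
  have : (F (j :: s') = cnt Z w l + F s')%N.
    rewrite /F /cnt -big_split /=; apply: eq_bigr => i _.
    rewrite /Z -/V; case: (boolP (V _)) => hV /=; last by rewrite andbT addn0.
    by rewrite andbF; have -> := forbidden_suffix [:: j] hV.
  by move=> e; move: hF; rewrite e; lia.
have hz : (cnt (fun x => V x && ~~ V (x + g)%N) w l <= cnt Z w l + g)%N.
  have [h _] := cnt_shift Z w l g; rewrite -cnt_shiftE in h.
  apply: leq_trans h; apply: leq_cnt => x /andP[h1 h2].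
  by rewrite /Z h2 andbT; apply: forbidden_shift.
(* The subset sum 0 alone forbids w + q d whenever w - p d is in [A]. *)
have hV0 : (cnt (fun d => A (w - p * d)%N) 1 D <= cnt V w l)%N.
  apply: cnt_dilate => // d hd Ad.
  rewrite /V -[s']cats0; apply: forbidden_suffix.
  apply/hasP; exists 0%N; first by rewrite inE.
  apply/hasP; exists d; first by rewrite mem_iota; lia.
  by rewrite Ad /= muln0 addn0.
have hAP f : (cnt (fun i => A (f + g * i)%N) 0 L)%:R <= lam * L%:R.
  by apply: hL; apply: pattern_free_affine.
have := almost_invariant_cnt VA hAP hz.
have Lr : 0 < L%:R :> K by rewrite ltr0n.
have -> : lam * L%:R * (l%:R - (cnt V w l)%:R) = L%:R * (lam * (l%:R - (cnt V w l)%:R)) by ring.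
rewrite natrD natrM (natrM _ L (g * L)) -mulrDr -mulrDr ler_pM2l // -addrA => h.
apply: (le_trans h); apply: lerD.
  by rewrite ler_wpM2l // lerB // ler_nat.
have -> : (L * (cnt Z w l + g + g * L))%:R + (g * L)%:R
    = L%:R * (cnt Z w l)%:R + (L * (L + 2) * g)%:R :> K.
  by rewrite !(natrM, natrD); ring.
apply: lerD; last by rewrite ler_nat leq_mul2l gH orbT.
by rewrite natrM -mulrA ler_pM2l // ler_pdivlMr ?ltr0n // -natrM ler_nat mulnC.
Qed.

Lemma cnt_rev A p w D : (p * D <= w)%N ->
  cnt (fun d => A (w - p * d)%N) 1 D = cnt (fun i => A (w - p * D + p * i)%N) 0 D.
Proof.
move=> hw; rewrite /cnt (reindex_inj rev_ord_inj) /=; apply: eq_bigr => i _.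
congr (nat_of_bool (A _)); have := ltn_ord i => iD.
have -> : (p * D = p * (1 + (D - i.+1)) + p * i)%N by rewrite -mulnDr; congr muln; lia.
have : (p * (1 + (D - i.+1)) + p * i <= w)%N.
  by rewrite -mulnDr; apply: leq_trans hw; rewrite leq_mul2l; lia.
by rewrite add0n; lia.
Qed.

(** The two outer pieces are bounded from above by [hup]; what they cannot hold must lie in the
    middle piece. *)
Lemma interval_lower (K : archiRealFieldType) (A : pred nat) (alpha e : K) (L a l b : nat) :
  (forall f l, (cnt A f l)%:R <= (alpha + e) * l%:R + L%:R) ->
  alpha * (a + l + b)%:R < (cnt A 0 (a + l + b))%:R ->
  (alpha + e) * l%:R - e * (a + l + b)%:R - 2 * L%:R <= (cnt A a l)%:R.
Proof.
move=> hup; rewrite !cntD !natrD !add0n.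
by have := hup 0%N a; have := hup (a + l)%N b; lra.
Qed.

(** As in [interval_lower], with the upper bound also spent on the other p - 1 residue classes
    modulo [p] of the middle interval. *)
Lemma progression_lower (K : archiRealFieldType) (p q : nat) (A : pred nat)
    (alpha e : K) (L a D b : nat) : (0 < p)%N -> 0 <= alpha + e -> (0 < L)%N ->
  (forall A, pattern_free p q A -> (cnt A 0 L)%:R <= (alpha + e) * L%:R) ->
  pattern_free p q A ->
  alpha * (a + p * D + b)%:R < (cnt A 0 (a + p * D + b))%:R ->
  (alpha + e) * D%:R - e * (a + p * D + b)%:R - (p%:R + 1) * L%:R
    <= (cnt (fun i => A (a + p * i)%N) 0 D)%:R.
Proof.
case: p => // p _ lam0 L0 hL hA.
have hup f l := cnt_pattern_free_le f l lam0 L0 hL hA.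
rewrite cntD (cntD A 0 a) cnt_residues big_ord_recl /= !natrD !add0n addn0.
have := hup 0%N a; have := hup (a + p.+1 * D)%N b.
have : (\sum_(r < p) cnt (fun i => A (a + r.+1 + p.+1 * i)%N) 0 D)%:R
      <= (alpha + e) * (p%:R * D%:R) + p%:R * L%:R.
  have -> : (alpha + e) * (p%:R * D%:R) + p%:R * L%:R
      = \sum_(r < p) ((alpha + e) * D%:R + L%:R).
    by rewrite sumr_const card_ord -mulr_natl; ring.
  rewrite natr_sum; apply: ler_sum => r _.
  by apply: (cnt_pattern_free_le 0 D lam0 L0 hL); apply: pattern_free_affine.
by rewrite natrM -natr1; lra.
Qed.

(** If a pattern-free [A] had density above [alpha] on a long interval while no long piece can
    exceed alpha + e, then the middle block would contain a cube based at some [w], at least alpha0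
    D / 2 values of [d] would have w - p d in [A], and the block after [w] would have density close
    to alpha + e. By [roth_step_cnt] that last block loses at least alpha0^2 D / 2 points, against
    errors of at most 3 alpha0^2 D / 8. *)
Lemma roth_increment (K : archiRealFieldType) (p q : nat) (alpha0 : K) : (0 < p)%N -> (0 < q)%N ->
  0 < alpha0 <= 1 -> exists2 e : K, 0 < e & forall alpha, alpha0 <= alpha ->
    roth_bound p q (alpha + e) -> roth_bound p q alpha.
Proof.
move=> p0 q0 /andP[a0 a1]; pose c : K := (p + q + 2)%:R.
have c0 : 0 < c by rewrite ltr0n addn2.
have aa0 : 0 < alpha0 ^+ 2 by rewrite exprn_gt0.
have aa1 : alpha0 ^+ 2 <= alpha0 by rewrite expr2 ger_pMl.
(* The interval used below has length [N] at most c D, so e N is at most alpha0^2 D / 8. *)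
have [e [e0 ec]] : exists e : K, 0 < e /\ e * c = alpha0 ^+ 2 / 8.
  exists (alpha0 ^+ 2 / (8 * c)); split; first by rewrite divr_gt0 // mulr_gt0.
  by rewrite invfM mulrA mulfVK ?gt_eqF.
exists e => //.
move=> alpha ha [L L0 hL].
(* First [k] is chosen from [L], then [H] from [k], then [D] from all of these, so that each error
   is at most alpha0^2 D / 8. *)
have [k [k1 hk]] : exists k, (0 < k)%N /\ 8 * (L * (q + 1))%:R / alpha0 ^+ 2 <= k%:R.
  have [k hk] := archi (8 * (L * (q + 1))%:R / alpha0 ^+ 2).
  by exists k.+1; split=> //; apply: (le_trans hk); rewrite ler_nat.
have kr : 0 < k%:R :> K by rewrite ltr0n.
have [|H [D1 hcube]] := @cube_lemma K p k (alpha0 / 2); first by rewrite divr_gt0.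
have [D2 hD2] := archi (8 * ((p + 3) * L + L * (L + 2) * ((p + q) * H))%:R / alpha0 ^+ 2).
have [D [DD1 DD2 DD0]] : exists D, [/\ D1 <= D, D2 <= D & 0 < D]%N.
  by exists (maxn (maxn D1 D2) 1); rewrite !leq_max !leqnn !orbT.
have D0 : 0 < D%:R :> K by rewrite ltr0n.
(* Room for p D points before the middle block, for the block of length [D] that contains [w], and
   for q D + 1 points from [w] on. *)
pose N := ((p + 1 + q) * D + 1)%N.
exists N; first by rewrite /N addn1.
move=> A hA; rewrite leNgt; apply/negP => hN.
have lam0 : 0 <= alpha + e by apply: addr_ge0; [apply: le_trans ha; exact: ltW | exact: ltW].
have hup f l := cnt_pattern_free_le f l lam0 L0 hL hA.
have hD : ((p + 3) * L + L * (L + 2) * ((p + q) * H))%:R <= alpha0 ^+ 2 / 8 * D%:R.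
  have : 8 * ((p + 3) * L + L * (L + 2) * ((p + q) * H))%:R / alpha0 ^+ 2 <= D%:R.
    by apply: (le_trans hD2); rewrite ler_nat.
  rewrite ler_pdivrMr // => h; lra.
have eN : e * N%:R <= alpha0 ^+ 2 / 8 * D%:R.
  rewrite -ec -(mulrA e c) ler_pM2l // -natrM ler_nat /N; clear -DD0; nia.
have aD : alpha0 * D%:R <= alpha * D%:R by rewrite ler_wpM2r // ltW.
have aaD : alpha0 ^+ 2 * D%:R <= alpha0 * D%:R by rewrite ler_wpM2r // ltW.
have aaD0 : 0 < alpha0 ^+ 2 * D%:R by rewrite mulr_gt0.
have hD' : (p%:R + 3) * L%:R + (L * (L + 2) * ((p + q) * H))%:R <= alpha0 ^+ 2 / 8 * D%:R.
  by move: hD; rewrite natrD natrM natrD.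
have hX : 0 <= (L * (L + 2) * ((p + q) * H))%:R :> K := ler0n _ _.
have pL : 0 <= p%:R * L%:R :> K by rewrite mulr_ge0.
have Lr : 0 <= L%:R :> K := ler0n _ _.
have eD : 0 <= e * D%:R by rewrite mulr_ge0 // ltW.
have hMid : alpha0 / 2 * D%:R <= (cnt A (p * D) D)%:R.
  have eNN : N = (p * D + D + (q * D + 1))%N by clear; rewrite /N; lia.
  by have := @interval_lower K A alpha e L (p * D) D (q * D + 1) hup; rewrite -eNN => /(_ hN); lra.
have [w [js [hw szjs hjs hc]]] := hcube D (p * D)%N A DD1 hMid.
have hwp : (p * D <= w)%N by case/andP: hw.
have hU : alpha0 / 2 * D%:R <= (cnt (fun d => A (w - p * d)%N) 1 D)%:R.
  have eNN : N = (w - p * D + p * D + (N - w))%N by clear -hw; rewrite /N; lia.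
  have := @progression_lower K p q A alpha e L (w - p * D) D (N - w) p0 lam0 L0 hL hA.
  by rewrite -eNN (cnt_rev _ hwp) => /(_ hN); lra.
have hJ : (alpha + e) * (q * D + 1)%:R - e * N%:R - 2 * L%:R <= (cnt A w (q * D + 1))%:R.
  have eNN : N = (w + (q * D + 1) + (N - (w + (q * D + 1))))%N.
    by clear -hw; rewrite /N; lia.
  have := @interval_lower K A alpha e L w (q * D + 1) (N - (w + (q * D + 1))) hup.
  by rewrite -eNN; apply.
have := roth_step_cnt p0 q0 k1 hA hwp szjs lam0 hjs hc hL L0.
have hk2 : (L * (q * D + 1))%:R / k%:R <= alpha0 ^+ 2 / 8 * D%:R.
  rewrite ler_pdivrMr // -mulrA mulrC -mulrA.
  have : 8 * (L * (q + 1))%:R <= alpha0 ^+ 2 * k%:R.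
    by rewrite [leRHS]mulrC -ler_pdivrMr.
  move=> h; have h' := ler_wpM2r (ltW D0) h.
  have : (L * (q * D + 1))%:R <= (L * (q + 1))%:R * D%:R :> K.
    by rewrite -natrM ler_nat; clear -DD0; nia.
  by lra.
have hLU : (alpha + e) * (alpha0 / 2 * D%:R) <= (alpha + e) * (cnt (fun d => A (w - p * d)%N) 1 D)%:R.
  by rewrite ler_wpM2l.
have haU : alpha0 * (alpha0 / 2 * D%:R) <= (alpha + e) * (alpha0 / 2 * D%:R).
  by apply: ler_wpM2r; [rewrite mulr_ge0 // ltW // divr_gt0 | lra].
rewrite mulrBr mulrDl.
by lra.
Qed.

(* The infimum of the densities satisfying [roth_bound] cannot be positive. *)
Lemma roth (K : archiRealFieldType) (p q : nat) (alpha : K) : (0 < p)%N -> (0 < q)%N -> 0 < alpha ->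
  exists2 M : nat, (0 < M)%N & forall A : pred nat,
    alpha * M%:R <= (cnt A 0 M)%:R -> ~ pattern_free p q A.
Proof.
move=> p0 q0 alpha0.
suff [M M0 hM] : roth_bound p q (alpha / 2).
  exists M => // A hA hfree; have := hM A hfree.
  have : 0 < alpha * M%:R by rewrite mulr_gt0 // ltr0n.
  by lra.
have mono (a b : K) : a <= b -> roth_bound p q a -> roth_bound p q b.
  move=> ab [M M0 hM]; exists M => // A hA; apply: le_trans (hM A hA) _.
  by rewrite ler_wpM2r.
have b1 : roth_bound p q (1 : K).
  by exists 1%N => // A _; rewrite mul1r ler_nat; exact: cnt_le.
set a := alpha / 2; have a0 : 0 < a by rewrite divr_gt0.
have [a1|a1] := leP 1 a; first by  exact: (mono _ _ a1 b1).
have [|e e0 he] := @roth_increment K p q a p0 q0; first by rewrite a0 ltW.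
have [m hm] := archi (1 / e); rewrite ler_pdivrMr // in hm.
(* The bound descends from the trivial density 1 in steps of [e], never below [a]; since m e >= 1,
   [m] steps reach [a]. *)
have hj j : roth_bound p q (Num.max a (1 - j%:R * e)).
  elim: j => [|j IH]; first by rewrite mul0r subr0 max_r // ltW.
  apply: he; first by rewrite le_max lexx.
  apply: (mono _ _ _ IH); rewrite ge_max -natr1 mulrDl mul1r.
  have -> : a <= Num.max a (1 - (j%:R * e + e)) + e.
    by apply: (@le_trans _ _ (a + e)); [rewrite lerDl ltW | rewrite lerD2r le_max lexx].
  have := lexx (Num.max a (1 - (j%:R * e + e))); rewrite {1}ge_max => /andP[_]; lra.
by have := hj m; rewrite max_l //; lra.
Qed.

(** * Counting solutions in dense sets of residues *)

Definition sol3 (G : finComNzRingType) (a b c : G) (A : {set G}) : {set G * G * G} :=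
  [set t | [&& t.1.1 \in A, t.1.2 \in A, t.2 \in A &
     a * t.1.1 + b * t.1.2 + c * t.2 == 0]].

(** The quotient of d m by n + 2 takes fewer than m + 1 values, and together with the prescribed
    remainder it determines [d]. *)
Lemma card_mulrn_fiber (n m : nat) (t : 'I_n.+2) : (0 < m)%N ->
  (#|[set d : 'I_n.+2 | d *+ m == t]| <= m)%N.
Proof.
case: m => // m _; pose f (d : 'I_n.+2) : 'I_m.+1 := inord (d * m.+1 %/ n.+2).
have hf (d : 'I_n.+2) : nat_of_ord (f d) = (d * m.+1 %/ n.+2)%N.
  by rewrite inordK // ltn_divLR // mulnC ltn_pmul2l.
rewrite -[leqRHS]card_ord; apply: (@leq_card_in _ _ f) => d d'.
rewrite !inE => /eqP hd /eqP hd' /(congr1 (@nat_of_ord _)); rewrite !hf => hq.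
apply/val_inj/eqP; rewrite -(eqn_pmul2r (ltn0Sn m)) /=; apply/eqP.
rewrite (divn_eq (d * m.+1) n.+2) (divn_eq (d' * m.+1) n.+2) hq; congr addn.
by move: hd hd'; rewrite !Zp_mulrn => <- /(congr1 val).
Qed.

Lemma pattern_eq (G : comNzRingType) (p q y e : nat) (x d : G) :
  q%:R * (x + d *+ y) + p%:R * (x + d *+ (y + (p + q) * e))
    + - (p + q)%:R * (x + d *+ (y + p * e)) = 0.
Proof. by rewrite -!(mulr_natr d) !(natrD, natrM); ring. Qed.

Definition pattern_pairs (n p q y e : nat) (A : {set 'I_n.+2}) : {set 'I_n.+2 * 'I_n.+2} :=
  [set xd | [&& xd.1 + xd.2 *+ y \in A, xd.1 + xd.2 *+ (y + p * e) \in A &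
      xd.1 + xd.2 *+ (y + (p + q) * e) \in A]].

(** A solution fixes [d *+ (p * e)], which leaves at most p e values of [d]; then [x] is
    determined. *)
Lemma card_pattern_pairs (n p q y e : nat) (A : {set 'I_n.+2}) :
  (0 < p)%N -> (0 < e)%N ->
  (#|pattern_pairs p q y e A| <= #|sol3 (q%:R) (p%:R) (- (p + q)%:R) A| * (p * e))%N.
Proof.
move=> p0 e0; set P := pattern_pairs _ _ _ _ _; set S := sol3 _ _ _ _.
pose f (xd : 'I_n.+2 * 'I_n.+2) := (xd.1 + xd.2 *+ y, xd.1 + xd.2 *+ (y + (p + q) * e),
   xd.1 + xd.2 *+ (y + p * e)).
have fS xd : xd \in P -> f xd \in S.
  rewrite !inE /= => /and3P[-> -> ->] /=; apply/eqP.
  exact: pattern_eq.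
rewrite -sum1_card (partition_big f (mem S)) //= -sum_nat_const.
apply: leq_sum => s sS; rewrite sum1_card.
apply: leq_trans (card_mulrn_fiber (s.2 - s.1.1) _); last by rewrite muln_gt0 p0.
set Q := (X in (#|X| <= _)%N).
have hQ xd : xd \in Q -> [/\ xd.1 = s.1.1 - xd.2 *+ y & xd.2 *+ (p * e) = s.2 - s.1.1].
  rewrite unfold_in => /andP[_ /eqP <-] /=; split; first by rewrite addrK.
  by rewrite mulrnDr opprD addrACA subrr add0r addrAC subrr add0r.
rewrite -(@card_in_imset _ _ snd (mem Q)); last first.
  move=> [x d] [x' d'] /hQ /= [-> _] /hQ /= [-> _] /= -> //.
by apply: subset_leq_card; apply/subsetP => _ /imsetP[xd /hQ[_ h] ->]; rewrite inE h.
Qed.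

(** Average over all progressions x, x + d, ..., x + (M - 1) d: a positive proportion of the pairs
    (x, d) has density at least alpha / 2 in [A], and each of those contains a pattern by [roth]. A
    solution comes from at most M^2 (p M) pairs. *)
Lemma varnavides (K : archiRealFieldType) (p q : nat) (alpha : K) :
  (0 < p)%N -> (0 < q)%N -> 0 < alpha ->
  exists2 c : K, 0 < c & forall n (A : {set 'I_n.+2}), alpha * n.+2%:R <= #|A|%:R ->
    c * n.+2%:R ^+ 2 <= #|sol3 (q%:R) (p%:R) (- (p + q)%:R) A|%:R.
Proof.
move=> p0 q0 a0; have a20 : 0 < alpha / 2 by rewrite divr_gt0.
have [M M0 hM] := roth p0 q0 a20.
have Mr : 0 < M%:R :> K by rewrite ltr0n.
exists (alpha / 2 / (M ^ 2 * (p * M))%:R) => [|n A hA].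
  by rewrite divr_gt0 // ltr0n !(muln_gt0, expn_gt0) p0 M0.
set S := sol3 _ _ _ _; set N := n.+2.
pose c (xd : 'I_n.+2 * 'I_n.+2) := (\sum_(m < M) ((xd.1 + xd.2 *+ m)%R \in A))%N.
pose good := [set xd | alpha / 2 * M%:R <= (c xd)%:R].
have hc : (\sum_xd c xd = N * (M * #|A|))%N.
  have -> : (\sum_xd c xd = \sum_x \sum_d c (x, d))%N.
    by rewrite (pair_bigA _ (fun x d => c (x, d))); apply: eq_bigr => -[].
  rewrite exchange_big /=.
  have -> : (N * (M * #|A|) = \sum_(d : 'I_N) \sum_(m < M) #|A|)%N.
    by rewrite !sum_nat_const !card_ord.
  apply: eq_bigr => d _; rewrite exchange_big /=; apply: eq_bigr => m _.
  rewrite -sum1_card [RHS]big_mkcond [RHS](reindex_inj (addrI (d *+ m))) /=.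
  by apply: eq_bigr => x _; rewrite addrC; case: (_ \in _).
have hgood : alpha / 2 * N%:R ^+ 2 <= #|good|%:R.
  have : (\sum_xd c xd)%:R <= \sum_xd ((xd \in good)%:R * M%:R + alpha / 2 * M%:R).
    rewrite natr_sum; apply: ler_sum => xd _; rewrite inE.
    case: (lerP (alpha / 2 * M%:R) (c xd)%:R) => h /=; last by rewrite mul0r add0r ltW.
    rewrite mul1r; apply: (@le_trans _ _ M%:R); last by rewrite lerDl mulr_ge0 // ltW.
    by rewrite ler_nat (cnt_le (fun m => xd.1 + xd.2 *+ m \in A) 0 M).
  rewrite hc big_split /= -mulr_suml -natr_sum sumr_const card_prod !card_ord.
  have -> : (\sum_xd (xd \in good) = #|good|)%N by rewrite -sum1_card [RHS]big_mkcond.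
  rewrite -mulr_natr !natrM -/N => h.
  have hA' : N%:R * (M%:R * (alpha * N%:R)) <= N%:R * (M%:R * #|A|%:R).
    by rewrite ler_wpM2l // ler_wpM2l.
  by rewrite -(ler_pM2r Mr) expr2; lra.
have hcover : (#|good| <= \sum_(y < M) \sum_(e < M)
    if (0 < e)%N then #|pattern_pairs p q y e A| else 0)%N.
  have -> : (\sum_(y < M) \sum_(e < M)
    (if (0 < e)%N then #|pattern_pairs p q y e A| else 0) =
     \sum_xd \sum_(y < M) \sum_(e < M) ((0 < e)%N && (xd \in pattern_pairs p q y e A)))%N.
    rewrite [RHS]exchange_big; apply: eq_bigr => y _.
    rewrite [RHS]exchange_big; apply: eq_bigr => e _.
    case: ifP => e0; last by rewrite big1.
    by rewrite -sum1_card [LHS]big_mkcond.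
  rewrite -sum1_card big_mkcond /=; apply: leq_sum => xd _; case: ifP => //.
  rewrite inE => hxd; rewrite lt0n sum_nat_eq0; apply/negP => /forallP h0.
  (* The restriction to m < M confines the pattern that is found to indices [y] and [e] below
     [M]. *)
  have := hM (fun m => (m < M)%N && (xd.1 + xd.2 *+ m \in A)); case.
    apply: (le_trans hxd); rewrite ler_nat leq_eqVlt; apply/orP; left; apply/eqP.
    by apply: eq_bigr => m _; rewrite ltn_ord.
  move=> y e e0 /andP[yM hy] /andP[_ hw]; apply/negP => /andP[vM hv].
  have eM : (e < M)%N by move: vM p0 e0; clear; nia.
  have := h0 (Ordinal yM); rewrite sum_nat_eq0 => /forallP /(_ (Ordinal eM)) /=.
  by rewrite e0 inE hy hw hv.
have hS : (#|good| <= M ^ 2 * (p * M) * #|S|)%N.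
  apply: (leq_trans hcover).
  apply: (@leq_trans (\sum_(y < M) \sum_(e < M) (p * M) * #|S|)).
    apply: leq_sum => y _; apply: leq_sum => e _; case: ifP => // e0.
    apply: (leq_trans (card_pattern_pairs q y A p0 e0)); rewrite mulnC leq_mul2r.
    by rewrite leq_mul2l (ltnW (ltn_ord e)) !orbT.
  by rewrite !sum_nat_const !card_ord -mulnn -!mulnA.
rewrite mulrAC ler_pdivrMr ?ltr0n ?(muln_gt0, expn_gt0) ?p0 ?M0 //.
by apply: (le_trans hgood); rewrite -natrM ler_nat mulnC.
Qed.

Lemma three_term_perm (G : comNzRingType) (m p : nat) (u v w : G) :
  p%:R * w + m%:R * u + - (m + p)%:R * v = 0 ->
  (m + p)%:R * v + - p%:R * w + - m%:R * u = 0.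
Proof. by move=> h; rewrite -[RHS]oppr0 -h; ring. Qed.

(** For a2 > 0 this is [varnavides]. For a2 < 0 put m = a1 + a2 > 0: the equation m u + |a2| w = a1
    v has the required shape up to signs and the order of the variables. *)
Lemma three_term (K : archiRealFieldType) (a1 a2 : int) (alpha : K) :
  0 < a1 -> a2 != 0 -> 0 < a1 + a2 -> 0 < alpha ->
  exists2 c : K, 0 < c & forall n (A : {set 'I_n.+2}), alpha * n.+2%:R <= #|A|%:R ->
    c * n.+2%:R ^+ 2 <= #|sol3 (a1%:~R) (a2%:~R) (- (a1 + a2)%:~R) A|%:R.
Proof.
case: a1 => // q q0; case: a2 => p p0 s0 a0.
  have [c c0 hc] := @varnavides K p q alpha ltac:(lia) ltac:(lia) a0.
  by exists c => // n A /hc; rewrite addnC.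
have [m em] : exists m, q = (m + p.+1)%N by exists (q - p.+1)%N; lia.
have m0 : (0 < m)%N by move: s0; rewrite em NegzE; lia.
have [c c0 hc] := @varnavides K m p.+1 alpha m0 isT a0.
exists c => // n A /hc h; apply: (le_trans h); rewrite ler_nat.
pose f (t : 'I_n.+2 * 'I_n.+2 * 'I_n.+2) := (t.2, t.1.1, t.1.2).
have fI : injective f by move=> [[u v] w] [[u' v'] w'] [-> -> ->].
rewrite -(card_imset _ fI); apply: subset_leq_card; apply/subsetP => _ /imsetP[t ht ->].
move: ht; rewrite !inE => /and4P[-> -> -> /eqP h0] /=; apply/eqP.
have -> : q%:Z + Negz p = m by rewrite em NegzE; lia.
rewrite em NegzE mulrNz; exact: three_term_perm.
Qed.

(* The number of solutions of [sum_i s_i x_i = y], each counted with weight [prod_i f x_i]. *)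
Fixpoint wcount (K : realFieldType) (G : finComNzRingType) (s : seq int) (f : G -> K) (y : G) : K :=
  if s is a :: s' then \sum_x f x * wcount s' f (y - a%:~R * x) else (y == 0)%:R.

Definition indic (K : realFieldType) (G : finComNzRingType) (A : {set G}) (x : G) : K := (x \in A)%:R.

Lemma sum_indic (K : realFieldType) (G : finComNzRingType) (A : {set G}) :
  \sum_x indic K A x = #|A|%:R.
Proof.
rewrite -sum1_card natr_sum [RHS]big_mkcond; apply: eq_bigr => x _.
by rewrite /indic; case: (_ \in _).
Qed.

Section WeightedCount.
Variables (K : realFieldType) (G : finComNzRingType).
Implicit Types (s : seq int) (f g : G -> K) (y : G).

Lemma wcount_ge0 s f y : (forall x, 0 <= f x) -> 0 <= wcount s f y.
Proof.
move=> f0; elim: s y => [|a s IH] y /=; first exact: ler0n.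
by apply: sumr_ge0 => x _; rewrite mulr_ge0.
Qed.

Lemma wcount_le s f g y : (forall x, 0 <= f x) -> (forall x, f x <= g x) ->
  wcount s f y <= wcount s g y.
Proof.
move=> f0 fg; elim: s y => [|a s IH] y //=.
by apply: ler_sum => x _; rewrite ler_pM // wcount_ge0.
Qed.

Lemma wcount_scale s f c y :
  wcount s (fun x => c * f x) y = c ^+ size s * wcount s f y.
Proof.
elim: s y => [|a s IH] y /=; first by rewrite mul1r.
rewrite mulr_sumr; apply: eq_bigr => x _; rewrite IH exprS; ring.
Qed.

End WeightedCount.

(** All variables but the last are free, and the last is determined because its coefficient is a
    unit. *)
Lemma wcount_ub (K : realFieldType) (G : finComUnitRingType) (a : int) (s : seq int)
    (f : G -> K) (y : G) : (forall x, 0 <= f x <= 1) ->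
  all (fun a : int => (a%:~R : G) \is a GRing.unit) (a :: s) ->
  wcount (a :: s) f y <= #|G|%:R ^+ size s.
Proof.
move=> hf; have f0 x : 0 <= f x by case/andP: (hf x).
have f1 x : f x <= 1 by case/andP: (hf x).
elim: s a y => [|b s IH] a y /= /andP[ua us].
  rewrite expr0 (bigD1 (y / a%:~R)) //= big1 => [|x xy]; last first.
    case: eqP => [e|]; last by rewrite mulr0.
    by move: xy; rewrite (subr0_eq e) mulrC mulKr ?eqxx.
  by rewrite addr0 -[leRHS]mulr1 ler_pM //; case: (_ == _).
apply: (@le_trans _ _ (\sum_(x : G) #|G|%:R ^+ size s)).
  apply: ler_sum => x _; rewrite -[leRHS]mul1r ler_pM //; last exact: IH.
  by apply: sumr_ge0 => z _; rewrite mulr_ge0 // wcount_ge0.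
by rewrite sumr_const -[leLHS]mulr_natl -exprS.
Qed.

Definition small_units (L n : nat) : Prop :=
  forall t : int, t != 0 -> (`|t| <= L)%N -> (t%:~R : 'I_n.+2) \is a GRing.unit.

Definition dense_count (K : archiRealFieldType) (L : nat) (s : seq int) : Prop :=
  forall alpha : K, 0 < alpha -> exists2 c : K, 0 < c &
    forall n (A : {set 'I_n.+2}), small_units L n -> alpha * n.+2%:R <= #|A|%:R ->
      c * n.+2%:R ^+ (size s).-1 <= wcount s (indic K A) 0.

(* Keep only those [w] for which [(a1 + a2) w + sum_i s_i x_i = 0] has many
   solutions [x]; three-term solutions inside that set then lift to solutions of
   the longer equation. *)
Lemma dense_count_step (K : archiRealFieldType) L (a1 a2 a : int) (s : seq int) :
  0 < a1 -> a2 != 0 -> 0 < a1 + a2 -> (`|(a1 + a2)%R| <= L)%N ->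
  all (fun a : int => (a != 0) && (`|a| <= L)%N) (a :: s) ->
  dense_count K L [:: a1 + a2, a & s] -> dense_count K L [:: a1, a2, a & s].
Proof.
move=> a10 a20 b0 bL hs IH alpha alpha0.
have [c1 c10 hc1] := IH alpha alpha0.
have c20 : 0 < c1 / 2 by rewrite divr_gt0.
have [c3 c30 hc3] := three_term a10 a20 b0 c20.
exists (c1 / 2 * c3) => [|n A hu hA]; first by rewrite mulr_gt0.
set N : K := n.+2%:R; set r := size s.
have N0 : 0 < N by rewrite ltr0n.
have Nr0 : 0 < N ^+ r by rewrite exprn_gt0.
pose b : 'I_n.+2 := (a1 + a2)%:~R.
have ub : b \is a GRing.unit by apply: hu => //; rewrite gt_eqF.
have hus : all (fun a : int => (a%:~R : 'I_n.+2) \is a GRing.unit) (a :: s).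
  by apply: sub_all hs => t /andP[t0 tL]; exact: hu.
pose W := wcount (a :: s) (indic K A).
have hI x : 0 <= indic K A x <= 1 by rewrite /indic; case: (_ \in _); rewrite ?lexx ler01.
have hI0 x : 0 <= indic K A x by case/andP: (hI x).
have W0 y : 0 <= W y by apply: wcount_ge0.
have W1 y : W y <= N ^+ r by have := wcount_ub y hI hus; rewrite card_ord.
pose A' := [set w in A | c1 / 2 * N ^+ r <= W (- (b * w))].
(* The [w] outside [A'] contribute at most half of the lower bound, and each [w] in [A'] at most
   N^r. *)
have hA' : c1 / 2 * N <= #|A'|%:R.
  have : c1 * N ^+ r.+1 <= \sum_w ((w \in A')%:R * N ^+ r + c1 / 2 * N ^+ r).
    apply: (le_trans (hc1 n A hu hA)) => /=; apply: ler_sum => w _.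
    rewrite -/(wcount (a :: s) (indic K A) _) -/W sub0r -/b inE /indic.
    case: (w \in A) => /=; last by rewrite !mulr0n !mul0r add0r mulr_ge0 // ltW.
    rewrite mul1r; case: (lerP (c1 / 2 * N ^+ r) (W (- (b * w)))) => h; last by rewrite mul0r add0r ltW.
    by rewrite mul1r; apply: (le_trans (W1 _)); rewrite lerDl mulr_ge0 // ltW.
  rewrite big_split /= -mulr_suml -/(indic K A' _) sum_indic sumr_const card_ord -/N.
  rewrite -mulr_natl -/N exprS => h.
  by rewrite -(ler_pM2r Nr0); lra.
have := hc3 n A' hA'; set S := sol3 _ _ _ _ => hS.
apply: (@le_trans _ _ (c1 / 2 * N ^+ r * #|S|%:R)).
  have -> : c1 / 2 * c3 * N ^+ (size [:: a1, a2, a & s]).-1 = c1 / 2 * N ^+ r * (c3 * N ^+ 2).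
    by rewrite /= !exprS expr0 -/r; ring.
  by rewrite ler_pM2l // mulr_gt0.
have -> : #|S|%:R = \sum_u \sum_v \sum_w ((u, v, w) \in S)%:R :> K.
  rewrite pair_bigA (pair_bigA _ (fun p w => ((p.1, p.2, w) \in S)%:R)) /=.
  rewrite -sum1_card natr_sum big_mkcond; apply: eq_bigr => -[[u v] w] _ /=.
  by case: (_ \in _).
rewrite mulr_sumr; apply: ler_sum => u _; rewrite !mulr_sumr; apply: ler_sum => v _.
rewrite -/(wcount (a :: s) (indic K A) _) -/W.
have [/existsP[w hw]|no] := boolP [exists w, (u, v, w) \in S]; last first.
  rewrite big1 => [|w _]; first by rewrite mulr0 !mulr_ge0.
  by move: no; rewrite negb_exists => /forallP/(_ w)/negbTE->.
(* As [b] is a unit, [u] and [v] determine [w], so the sum over [w] has only one nonzero term. *)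
have uniq_w w' : (u, v, w') \in S -> w' = w.
  move: hw; rewrite !inE /= => /and4P[_ _ _ /eqP h] /and4P[_ _ _ /eqP h'].
  apply: (mulrI ub); rewrite -h in h'; move/addrI: h'.
  by rewrite !mulNr => /oppr_inj.
rewrite (bigD1 w) //= hw big1 ?addr0 => [|w' ww']; last first.
  by case: (boolP (_ \in S)) => // /uniq_w e; rewrite e eqxx in ww'.
move: hw; rewrite !inE /= => /and4P[/andP[Au _] /andP[Av _] /andP[_ hw] /eqP h].
rewrite /indic Au Av !mul1r mulr1.
suff -> : 0 - a1%:~R * u - a2%:~R * v = - (b * w) by [].
by rewrite -h /b; ring.
Qed.

(** The diagonal solutions alone number [#|A|], and the exponent is 1. *)
Lemma dense_count_base (K : archiRealFieldType) L (a : int) : dense_count K L [:: a; - a].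
Proof.
move=> alpha alpha0; exists alpha => // n A _ hA; rewrite expr1 (le_trans hA) //.
rewrite -sum_indic /=; apply: ler_sum => u _.
rewrite -[leLHS]mulr1 /indic; case: (boolP (u \in A)) => Au; last by rewrite !mul0r.
rewrite !mul1r (bigD1 u) //= Au mul1r mulrNz mulNr opprK sub0r addNr eqxx lerDl.
by apply: sumr_ge0 => v _; rewrite mulr_ge0.
Qed.

(** Merging the first two coefficients keeps the head positive: if [a2] is negative, so is
    everything after it, and the zero sum forces a + a2 > 0. The head is not compared with the tail,
    so the merged list fits the induction. *)
Lemma dense_count_sorted (K : archiRealFieldType) L (a : int) (s : seq int) : 0 < a ->
  sorted (fun x y : int => y <= x) s -> all (fun x : int => x != 0) s ->
  a + \sum_(x <- s) x = 0 -> (`|a| + \sum_(x <- s) `|x| <= L)%N ->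
  dense_count K L (a :: s).
Proof.
elim: s a => [|a2 s IH] a a0 hsort /=; first by rewrite big_nil; lia.
case/andP=> a20 hs0; rewrite !big_cons => hsum hL.
case: s IH hsort hs0 hsum hL => [|a3 s] IH hsort hs0 hsum hL.
  rewrite big_nil in hsum; have -> : a2 = - a by move: hsum; clear; lia.
  exact: dense_count_base.
have ab0 : 0 < a + a2.
  have [a2p|a2n] := ltP 0 a2; first by rewrite addr_gt0.
  have a2neg : a2 < 0 by rewrite lt_neqAle a20.
  have hall : all (fun x : int => x < 0) (a3 :: s).
    have := order_path_min (fun y x z xy yz => le_trans yz xy) hsort.
    by apply: sub_all => x xa; apply: le_lt_trans a2neg.
  have : \sum_(x <- a3 :: s) x < 0.
    rewrite big_cons; case/andP: hall => h3 hall.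
    have : \sum_(x <- s) x <= 0.
      rewrite big_seq; apply: sumr_le0 => x /(allP hall); exact: ltW.
    by move=> hS; rewrite -[ltRHS]addr0 ltr_leD.
  by move: hsum; rewrite addrA => /eqP; rewrite addr_eq0 => /eqP->; rewrite oppr_gt0.
have hbound x : x \in a3 :: s -> (`|x| <= \sum_(x <- a3 :: s) `|x|)%N.
  by move=> hx; rewrite (big_rem x hx) /= leq_addr.
apply: dense_count_step => //.
- by move: hL; clear; lia.
- apply/allP => x hx; rewrite (allP hs0 x hx) /=.
  by have := hbound x hx; move: hL; clear; lia.
- apply: IH => //.
  + exact: (path_sorted hsort).
  + by rewrite -addrA.
  + by move: hL; clear; lia.
Qed.

Local Open Scope complex_scope.

(** * Fourier transform and transference *)

Lemma prim_root_exists (C : numClosedFieldType) n :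
  (0 < n)%N -> exists z : C, n.-primitive_root z.
Proof.
move=> n0; have [rs e] := closed_field_poly_normal ('X^n - 1 : {poly C}).
rewrite (monicP _) ?monicXnsubC // scale1r in e.
have /hasP[z _ hz] : has n.-primitive_root rs; last by exists z.
apply: has_prim_root => //.
- by apply/allP => z; rewrite -root_prod_XsubC -e.
- by rewrite -separable_prod_XsubC -e separable_Xn_sub_1 // pnatr_eq0 -lt0n.
- by rewrite -ltnS -(size_prod_XsubC rs id) -e size_XnsubC.
Qed.

(** The norm of [R[i]] takes its values in [R[i]]; this modulus lives in [R], where the order is
    total. *)
Definition nm (R : rcfType) (z : R[i]) : R := Normc.normc z.

Section Modulus.
Variable R : rcfType.
Implicit Types z w : R[i].

Lemma nmE z : (nm z)%:C = `|z|.
Proof. by case: z => a b; rewrite normc_def. Qed.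

Lemma nm_ge0 z : 0 <= nm z. Proof. by rewrite -ler0c nmE. Qed.
Lemma nmM z w : nm (z * w) = nm z * nm w. Proof. exact: Normc.normcM. Qed.
Lemma nm0 : nm (0 : R[i]) = 0. Proof. exact: Normc.normc0. Qed.
Lemma nm1 : nm (1 : R[i]) = 1. Proof. exact: Normc.normc1. Qed.

Lemma nmD z w : nm (z + w) <= nm z + nm w.
Proof. by rewrite -lecR rmorphD /= !nmE ler_normD. Qed.

Lemma nmN z : nm (- z) = nm z.
Proof. by apply: complexI; rewrite /= !nmE normrN. Qed.

Lemma nm_real (x : R) : nm (x%:C) = `|x|.
Proof. by rewrite /nm /= expr0n addr0 sqrtr_sqr. Qed.

Lemma nm_sqr z : ((nm z) ^+ 2)%:C = z * z^*.
Proof. by rewrite rmorphXn /= nmE sqr_normc. Qed.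

Lemma nm_sum (I : finType) (F : I -> R[i]) : nm (\sum_i F i) <= \sum_i nm (F i).
Proof.
elim/big_rec2: _ => [|i x y _ h]; first by rewrite nm0.
by apply: le_trans (nmD _ _) _; rewrite lerD2l.
Qed.

End Modulus.

Section Fourier.
Variables (R : rcfType) (G : finComNzRingType) (e : G -> R[i]).
Hypotheses (eD : forall x y, e (x + y) = e x * e y) (e1 : forall x, nm (e x) = 1)
  (eI : forall x, e x = 1 -> x = 0).
Implicit Types (f : G -> R) (s : seq int).

Lemma char0 : e 0 = 1.
Proof.
have e00 : e 0 != 0 by apply/eqP => h; have := e1 0; rewrite h nm0 => /eqP; rewrite eq_sym oner_eq0.
by apply: (mulfI e00); rewrite -eD addr0 mulr1.
Qed.

Lemma charN x : e (- x) = (e x)^*.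
Proof.
have h : e x * (e x)^* = 1 by rewrite -nm_sqr e1 expr1n.
have ex0 : e x != 0 by apply/eqP => h0; move/eqP: h; rewrite h0 mul0r eq_sym oner_eq0.
by apply: (mulfI ex0); rewrite h -eD subrr char0.
Qed.

(** Replacing r by 1 + r multiplies the sum by [e x], which differs from 1 unless x = 0. *)
Lemma sum_char x : \sum_r e (r * x) = (x == 0)%:R * #|G|%:R.
Proof.
have [->|x0] := eqVneq x 0.
  under eq_bigr do rewrite mulr0 char0.
  by rewrite sumr_const mul1r.
rewrite mul0r; have : e x * (\sum_r e (r * x)) = \sum_r e (r * x).
  rewrite [RHS](reindex_inj (addrI 1)) mulr_sumr; apply: eq_bigr => r _ /=.
  by rewrite mulrDl mul1r eD.
move/eqP; rewrite -subr_eq0 -[X in _ - X]mul1r -mulrBl mulf_eq0 subr_eq0.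
by case/orP => /eqP // /eI h; rewrite h eqxx in x0.
Qed.

Definition ft f (r : G) : R[i] := \sum_x (f x)%:C * e (r * x).

Lemma wcount_fourier s f y : (#|G|%:R * wcount s f y)%:C =
  \sum_r e (- (r * y)) * \prod_(a <- s) ft f (r * a%:~R).
Proof.
elim: s y => [|a s IH] y.
  under eq_bigr do rewrite big_nil mulr1 -mulrN.
  by rewrite sum_char oppr_eq0 /= rmorphM /= mulrC !rmorph_nat.
rewrite /= mulr_sumr rmorph_sum /=.
under eq_bigr => x _ do rewrite mulrCA rmorphM /= IH mulr_sumr.
rewrite exchange_big /=; apply: eq_bigr => r _.
rewrite big_cons mulrCA /ft big_distrl /=; apply: eq_bigr => x _.
rewrite mulrBr opprB addrC eD mulrA !mulrA; ring.
Qed.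

(** On the Fourier side the coefficients enter through a commutative product. *)
Lemma wcount_perm s s' f y : perm_eq s s' -> wcount s f y = wcount s' f y.
Proof.
move=> h; have N0 : #|G|%:R != 0 :> R by rewrite pnatr_eq0 -lt0n; apply/card_gt0P; exists 0.
apply: (mulfI N0); apply: complexI; rewrite /= !wcount_fourier.
by apply: eq_bigr => r _; rewrite (perm_big _ h).
Qed.

Lemma nm_ft_le f r : (forall x, 0 <= f x) -> nm (ft f r) <= \sum_x f x.
Proof.
move=> f0; apply: (le_trans (nm_sum _)); apply: ler_sum => x _.
by rewrite nmM e1 mulr1 nm_real ger0_norm.
Qed.

(* [wcount [:: 1; -1; 1; -1] f 0] is the additive energy of [f]. *)
Lemma ft_energy f :
  \sum_r nm (ft f r) ^+ 4 = #|G|%:R * wcount [:: 1; -1; 1; -1] f 0.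
Proof.
apply: complexI; rewrite wcount_fourier rmorph_sum /=; apply: eq_bigr => r _.
rewrite mulr0 oppr0 char0 mul1r !big_cons big_nil mulr1 !mulrNz !mulr1z mulrN1.
have -> : ft f (- r) = (ft f r)^*.
  rewrite /ft rmorph_sum /=; apply: eq_bigr => x _.
  by rewrite mulNr charN rmorphM; congr (_ * _); apply/esym; exact: conjc_real.
by rewrite mulr1 mulrA -nm_sqr -rmorphM /= -exprD.
Qed.


End Fourier.

(** Telescoping: the factors are exchanged one at a time. *)
Lemma nm_prod_sub (R : rcfType) (I : eqType) (s : seq I) (u v : I -> R[i]) (t d : R) :
  (forall i, i \in s -> [/\ nm (u i) <= t, nm (v i) <= t & nm (u i - v i) <= d]) ->
  nm (\prod_(i <- s) u i - \prod_(i <- s) v i) <= (size s)%:R * d * t ^+ (size s).-1.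
Proof.
elim: s => [|i s IH] hs; first by rewrite !big_nil subrr nm0 !mul0r.
have [ut vt uvd] := hs i (mem_head _ _).
have t0 : 0 <= t by apply: le_trans ut; exact: nm_ge0.
have d0 : 0 <= d by apply: le_trans uvd; exact: nm_ge0.
have hs' j : j \in s -> [/\ nm (u j) <= t, nm (v j) <= t & nm (u j - v j) <= d].
  by move=> js; apply: hs; rewrite inE js orbT.
have hu : nm (\prod_(j <- s) u j) <= t ^+ size s.
  elim: s hs' {IH hs} => [|j s IH] h; first by rewrite big_nil nm1.
  rewrite big_cons nmM exprS ler_pM ?nm_ge0 //; first by have [] := h j (mem_head _ _).
  by apply: IH => l ls; apply: h; rewrite inE ls orbT.
rewrite !big_cons.
have -> : u i * \prod_(j <- s) u j - v i * \prod_(j <- s) v j =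
   (u i - v i) * \prod_(j <- s) u j + v i * (\prod_(j <- s) u j - \prod_(j <- s) v j) by ring.
apply: (le_trans (nmD _ _)); rewrite !nmM /=.
have h1 : nm (u i - v i) * nm (\prod_(j <- s) u j) <= d * t ^+ size s.
  by rewrite ler_pM ?nm_ge0.
have h2 : nm (v i) * nm (\prod_(j <- s) u j - \prod_(j <- s) v j)
    <= (size s)%:R * d * t ^+ size s.
  apply: (le_trans (ler_pM _ _ vt (IH hs'))); rewrite ?nm_ge0 //.
  case: (s) => [|j s']; first by rewrite !mul0r mulr0.
  by rewrite /= exprS mulrCA.
by rewrite -natr1 mulrDl mul1r mulrDl addrC; apply: lerD.
Qed.

Lemma seq_max (R : realDomainType) (I : eqType) (s : seq I) (t : I -> R) :
  s != [::] -> exists2 i, i \in s & forall j, j \in s -> t j <= t i.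
Proof.
elim: s => // i s IH _; have [->|s0] := eqVneq s [::].
  by exists i; rewrite ?mem_head // => j; rewrite inE => /eqP->.
have [m ms hm] := IH s0; have [h|h] := leP (t m) (t i).
  exists i; first exact: mem_head.
  by move=> j; rewrite inE => /predU1P[->//|/hm h']; apply: le_trans h.
exists m; first by rewrite inE ms orbT.
by move=> j; rewrite inE => /predU1P[->|/hm//]; apply: ltW.
Qed.

(* At most [k - 5] of the factors are estimated by the trivial bound [b]; four of
   them are paid for by the fourth moments. *)
Lemma nm_prod_sub4 (R : rcfType) (I : eqType) (s : seq I) (u v : I -> R[i]) (b d : R) :
  (5 <= size s)%N -> 0 <= d ->
  (forall i, i \in s -> [/\ nm (u i) <= b, nm (v i) <= nm (u i) & nm (u i - v i) <= d]) ->
  nm (\prod_(i <- s) u i - \prod_(i <- s) v i) <=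
    (size s)%:R * d * b ^+ (size s - 5) * \sum_(i <- s) nm (u i) ^+ 4.
Proof.
move=> sz d0 hs; have sn : s != [::] by case: (s) sz.
(* Telescoping is done with the largest modulus t = nm (u m); then t^(k-1) = t^(k-5) t^4, where t^4
   is one of the terms of the sum. *)
have [m ms hm] := seq_max (fun i => nm (u i)) sn.
have [mb _ _] := hs m ms.
apply: (le_trans (@nm_prod_sub _ _ s u v (nm (u m)) d _)).
  by move=> i si; have [_ h1 h2] := hs i si; split=> //; [exact: hm | apply: le_trans h1 (hm i si)].
rewrite -[leRHS]mulrA ler_wpM2l //; first by rewrite mulr_ge0.
have -> : (size s).-1 = (size s - 5 + 4)%N by move: sz; clear; lia.
rewrite exprD ler_pM ?exprn_ge0 ?nm_ge0 //.
  by rewrite lerXn2r // nnegrE ?nm_ge0 // (le_trans _ mb) ?nm_ge0.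
rewrite (big_rem m ms) /= lerDl; apply: sumr_ge0 => i _; exact: (exprn_ge0 _ (nm_ge0 _)).
Qed.

Lemma circle_cells (R : realType) (eta : R) : 0 < eta ->
  exists c : nat, exists cell : R[i] -> 'I_c.+1 * 'I_c.+1,
    forall z w, nm z = 1 -> nm w = 1 -> cell z = cell w -> nm (z - w) <= eta.
Proof.
move=> eta0; have [m hm] := archi (2 / eta).
have m0 : 0 < m%:R :> R by apply: lt_le_trans hm; rewrite divr_gt0.
(* For x in [-1, 1] the floor lies between 0 and 2 m, so the absolute value changes nothing and 2 m
   + 1 cells suffice for each coordinate; their width 1 / m is at most eta / 2. *)
pose g (x : R) : nat := `|Num.floor (m%:R * x + m%:R)|%N.
have hfl (x : R) : `|x| <= 1 -> (g x)%:R = (Num.floor (m%:R * x + m%:R))%:~R :> R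
    /\ (g x <= 2 * m)%N.
  rewrite ler_norml => /andP[x1 x2].
  have y0 : 0 <= m%:R * x + m%:R.
    by rewrite -[X in _ + X]mulr1 -mulrDr mulr_ge0 ?(ltW m0) //; lra.
  have f0 : 0 <= Num.floor (m%:R * x + m%:R) by rewrite floor_ge0.
  have e : (g x)%:R = (Num.floor (m%:R * x + m%:R))%:~R :> R by rewrite /g -[in RHS](gez0_abs f0).
  split=> //; rewrite -(ler_nat R) e; apply: (le_trans (floor_le _)).
  have : m%:R * x <= m%:R by rewrite -[leRHS]mulr1 ler_pM2l.
  by rewrite natrM; lra.
have hg (x y : R) : `|x| <= 1 -> `|y| <= 1 -> g x = g y -> `|x - y| <= eta / 2.
  move=> x1 y1 gxy; have [ex _] := hfl x x1; have [ey _] := hfl y y1.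
  have /andP[a1 a2] := floor_itv (m%:R * x + m%:R).
  have /andP[b1 b2] := floor_itv (m%:R * y + m%:R).
  rewrite rmorphD /= -ex in a1 a2; rewrite rmorphD /= -ey -gxy in b1 b2.
  have : `|m%:R * (x - y)| <= 1 by rewrite ler_norml mulrBr; apply/andP; split; lra.
  rewrite normrM gtr0_norm // mulrC -ler_pdivlMr // => h; apply: (le_trans h).
  rewrite ler_pdivrMr // mulrC -ler_pdivrMr ?divr_gt0 //.
  by apply: le_trans hm; rewrite invf_div mul1r.
exists (2 * m)%N, (fun z => (inord (g (complex.Re z)), inord (g (complex.Im z)))).
move=> z w z1 w1 [hre him].
have hRe t : nm t = 1 :> R -> `|complex.Re t| <= 1 /\ `|complex.Im t| <= 1.
  case: t => a b ht /=.
  have : a ^+ 2 + b ^+ 2 = 1.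
    have := nm_sqr (a +i* b); rewrite ht expr1n => /eqP; rewrite eq_complex /= => /andP[/eqP h _].
    by rewrite h; ring.
  have := sqr_ge0 a; have := sqr_ge0 b => b0 a0 h.
  by split; rewrite -(@ler_pXn2r _ 2) ?nnegrE // expr1n real_normK ?num_real //; lra.
have [z2 z3] := hRe z z1; have [w2 w3] := hRe w w1.
have g2 (x : R) : `|x| <= 1 -> (g x < (2 * m).+1)%N by move=> /hfl[_]; rewrite ltnS.
have gre : g (complex.Re z) = g (complex.Re w) by move: (congr1 val hre); rewrite /= !inordK ?g2.
have gim : g (complex.Im z) = g (complex.Im w) by move: (congr1 val him); rewrite /= !inordK ?g2.
have h1 := hg _ _ z2 w2 gre; have h2 := hg _ _ z3 w3 gim.
have -> : z - w = (complex.Re z - complex.Re w)%:C + 'i * (complex.Im z - complex.Im w)%:C.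
  case: z w {z1 w1 hre him z2 z3 w2 w3 gre gim h1 h2} => a b [a' b'].
  by apply/eqP; rewrite eq_complex /=; apply/andP; split; apply/eqP; ring.
apply: (le_trans (nmD _ _)); rewrite nmM !nm_real.
have -> : nm ('i : R[i]) = 1 by rewrite /nm /= expr0n add0r expr1n sqrtr1.
by rewrite mul1r; lra.
Qed.

Lemma pigeonhole_set (G T : finType) (P : {set G}) (g : G -> T) : P != set0 ->
  exists t, (#|P| <= #|T| * #|[set x in P | g x == t]|)%N.
Proof.
move=> P0; apply/existsP; apply: contraT; rewrite negb_exists => /forallP h.
have /set0Pn[x0 _] := P0.
have : (\sum_t #|[set x in P | g x == t]| = #|P|)%N.
  rewrite -[RHS]sum1_card (partition_big g predT) //=; apply: eq_bigr => t _.
  by rewrite -sum1_card; apply: eq_bigl => x; rewrite inE.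
have T0 : (0 < #|T|)%N by apply/card_gt0P; exists (g x0).
have : (\sum_(t : T) #|T| * #|[set x in P | g x == t]| < \sum_(t : T) #|P|)%N.
  rewrite (bigD1 (g x0)) //= [ltnRHS](bigD1 (g x0)) //= -addSn leq_add //.
    by rewrite ltnNge.
  by apply: leq_sum => t _; apply: ltnW; rewrite ltnNge.
by rewrite -big_distrr /= sum_nat_const => h1 h2; rewrite h2 ltnn in h1.
Qed.

(** Refine a set [P] by one frequency at a time, keeping the most popular cell, so that each
    character varies little on [P]. Translating [P] by one of its points makes the nearly constant
    value equal to 1. *)
Lemma common_almost_period (R : realType) (eta : R) : 0 < eta ->
  exists c : nat, forall (G : finComNzRingType) (e : G -> R[i]),
    (forall x y, e (x + y) = e x * e y) -> (forall x, nm (e x) = 1) ->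
    forall rs : seq G, exists D : {set G}, (#|G| <= c ^ size rs * #|D|)%N /\
      forall r d, r \in rs -> d \in D -> nm (1 - e (r * d)) <= eta.
Proof.
move=> eta0; have [m [cell hcell]] := circle_cells eta0.
exists #|{: 'I_m.+1 * 'I_m.+1}| => G e eD e1 rs.
set c := #|{: 'I_m.+1 * 'I_m.+1}|.
have [P [hP hPe]] : exists P : {set G}, (#|G| <= c ^ size rs * #|P|)%N /\
    forall r x y, r \in rs -> x \in P -> y \in P -> nm (e (r * x) - e (r * y)) <= eta.
  elim: rs => [|r rs [P [hP hPe]]]; first by exists setT; rewrite mul1n cardsT.
  have P0 : P != set0.
    by apply/eqP => h; move: hP; rewrite h cards0 muln0 leqNgt; apply/negP/negPn/card_gt0P; exists 0.
  have [t ht] := pigeonhole_set (fun x => cell (e (r * x))) P0.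
  exists [set x in P | cell (e (r * x)) == t]; split.
    by apply: (leq_trans hP); rewrite /= expnSr -mulnA; exact: leq_mul (leqnn _) ht.
  move=> r' x y; rewrite inE => /predU1P[->|hr']; rewrite !inE.
    by move=> /andP[_ /eqP hx] /andP[_ /eqP hy]; apply: hcell; rewrite ?e1 // hx hy.
  by move=> /andP[xP _] /andP[yP _]; apply: hPe.
have /card_gt0P[p0 p0P] : (0 < #|P|)%N.
  rewrite lt0n; apply/eqP => h; move: hP; rewrite h muln0 leqNgt; apply/negP/negPn/card_gt0P.
  by exists 0.
exists [set x - p0 | x in P]; split; first by rewrite card_imset //; exact: addIr.
move=> r d hr /imsetP[x xP ->].
have -> : 1 - e (r * (x - p0)) = e (r * - p0) * (e (r * p0) - e (r * x)).
  by rewrite [RHS]mulrBr -!eD -!mulrDr addNr mulr0 (char0 eD e1) [- p0 + x]addrC.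
by rewrite nmM e1 mul1r; apply: hPe.
Qed.

(** * Averaging over translates and its effect on solution counts *)

Definition avg (R : realType) (G : finComNzRingType) (D : {set G}) (f : G -> R) (x : G) : R :=
  #|D|%:R^-1 * \sum_(d in D) f (x - d).

Section Transfer.
Variables (R : realType) (G : finComUnitRingType) (e : G -> R[i]).
Hypotheses (eD : forall x y, e (x + y) = e x * e y) (e1 : forall x, nm (e x) = 1)
  (eI : forall x, e x = 1 -> x = 0).
Implicit Types (f : G -> R) (s : seq int) (D : {set G}).

Lemma ft_avg D f r :
  ft e (avg D f) r = (#|D|%:R^-1 * \sum_(d in D) e (r * d)) * ft e f r.
Proof.
rewrite {1}/ft /avg.
under eq_bigr => x _ do rewrite rmorphM /= fmorphV rmorph_nat -mulrA rmorph_sum /= mulr_suml.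
rewrite -mulr_sumr -mulrA; congr (_ * _); rewrite exchange_big mulr_suml.
apply: eq_bigr => d _; rewrite (reindex_inj (addIr d)) /ft mulr_sumr.
by apply: eq_bigr => x _; rewrite addrK mulrDr eD; ring.
Qed.

Lemma nm_natV (n : nat) : nm (n%:R^-1 : R[i]) = n%:R^-1.
Proof.
have -> : n%:R^-1 = (n%:R^-1 : R)%:C by rewrite fmorphV rmorph_nat.
by rewrite nm_real ger0_norm // invr_ge0.
Qed.

Lemma nm_ft_avg D f r : nm (ft e (avg D f) r) <= nm (ft e f r).
Proof.
rewrite ft_avg nmM -[leRHS]mul1r ler_wpM2r ?nm_ge0 // nmM nm_natV.
have [->|D0] := eqVneq #|D| 0%N; first by rewrite invr0 mul0r ler01.
have Dr : 0 < #|D|%:R :> R by rewrite ltr0n lt0n.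
rewrite mulrC ler_pdivrMr // mul1r big_mkcond; apply: (le_trans (nm_sum _)).
rewrite -sum1_card natr_sum [leRHS]big_mkcond; apply: ler_sum => d _.
by case: (d \in D); rewrite ?nm0 ?e1.
Qed.

Lemma nm_ft_sub_avg D f r (eta : R) : D != set0 -> (forall d, d \in D -> nm (1 - e (r * d)) <= eta) ->
  nm (ft e f r - ft e (avg D f) r) <= eta * nm (ft e f r).
Proof.
rewrite -card_gt0 => D0 hD; have Dr : 0 < #|D|%:R :> R by rewrite ltr0n.
rewrite ft_avg -[X in X - _]mul1r -mulrBl nmM ler_wpM2r ?nm_ge0 //.
have -> : 1 - #|D|%:R^-1 * \sum_(d in D) e (r * d)
   = #|D|%:R^-1 * \sum_(d in D) (1 - e (r * d)).
  rewrite sumrB mulrBr sumr_const mulVf // pnatr_eq0 -lt0n //.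
rewrite nmM nm_natV mulrC ler_pdivrMr // big_mkcond; apply: (le_trans (nm_sum _)).
rewrite mulr_natr -sumr_const [leRHS]big_mkcond; apply: ler_sum => d _.
by case: (boolP (d \in D)) => [/hD|_]; rewrite ?nm0.
Qed.

(** Every transform moves by at most eta times the sum of [f]: where it is small by the triangle
    inequality, elsewhere because the characters are close to 1 on [D]. Then [nm_prod_sub4] applies
    at each frequency; since each coefficient is a unit it permutes the frequencies, so every sum of
    fourth powers is the same energy. One factor [size s] comes from telescoping, the other from
    summing over the coefficients. *)
Lemma wcount_avg_close s D f (eta : R) :
  (5 <= size s)%N -> all (fun a : int => (a%:~R : G) \is a GRing.unit) s ->
  (forall x, 0 <= f x) -> D != set0 -> 0 <= eta ->
  (forall r, 2 * nm (ft e f r) <= eta * (\sum_x f x) \/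
     forall d, d \in D -> nm (1 - e (r * d)) <= eta) ->
  `|wcount s f 0 - wcount s (avg D f) 0| <=
    (size s)%:R ^+ 2 * eta * (\sum_x f x) ^+ (size s - 4) * wcount [:: 1; -1; 1; -1] f 0.
Proof.
move=> sz hs f0 D0 eta0 hr; set b := \sum_x f x; set k := size s.
set E := wcount [:: 1; -1; 1; -1] f 0.
have N0 : 0 < #|G|%:R :> R by rewrite ltr0n; apply/card_gt0P; exists 0.
rewrite -(ler_pM2l N0) -[X in X * `|_|](gtr0_norm N0) -normrM -nm_real mulrBr.
have -> (x y : R) : (x - y)%:C = x%:C - y%:C by rewrite rmorphB.
rewrite !(wcount_fourier eD e1 eI) -sumrB; apply: (le_trans (nm_sum _)).
have b0 : 0 <= b by apply: sumr_ge0.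
have hpt r : nm (e (- (r * 0)) * \prod_(a <- s) ft e f (r * a%:~R) -
     e (- (r * 0)) * \prod_(a <- s) ft e (avg D f) (r * a%:~R)) <=
   k%:R * (eta * b) * b ^+ (k - 5) * \sum_(a <- s) nm (ft e f (r * a%:~R)) ^+ 4.
  rewrite -mulrBr nmM e1 mul1r; apply: nm_prod_sub4 => //; first by rewrite mulr_ge0.
  move=> a _; set t := r * _; split; [exact: nm_ft_le | exact: nm_ft_avg |].
  have hb : nm (ft e f t) <= b by exact: nm_ft_le.
  have [h|h] := hr t; last by apply: (le_trans (nm_ft_sub_avg f D0 h)); rewrite ler_wpM2l.
  apply: (le_trans (nmD _ _)); rewrite nmN; have h' := nm_ft_avg D f t.
  by apply: le_trans h; rewrite mulr_natl mulr2n lerD.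
apply: (le_trans (ler_sum _ (fun r _ => hpt r))).
rewrite -mulr_sumr exchange_big /= big_seq.
rewrite (eq_bigr (fun=> #|G|%:R * E)) => [|a ha]; last first.
  rewrite -(ft_energy eD e1 eI) [RHS](reindex_inj (mulIr (allP hs a ha))) //.
rewrite -big_seq big_const_seq count_predT iter_addr_0 -(mulr_natl (#|G|%:R * E)) -/k.
have -> : (k - 4 = (k - 5).+1)%N by move: sz; rewrite -/k; clear; lia.
by rewrite (exprS b) le_eqVlt; apply/orP; left; apply/eqP; ring.
Qed.
End Transfer.

(** * Energy and second moment for sets with few repeated differences *)

Section FewDifferences.
Variables (R : realType) (G : finComNzRingType) (S : {set G}) (C : R).
Hypotheses (C0 : 0 <= C)
  (hS : forall h, h != 0 -> #|[set y in S | y + h \in S]|%:R <= C).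

Let f : G -> R := indic R S.

Lemma sum_indic_shift h :
  \sum_x f x * f (x + h) = #|[set y in S | y + h \in S]|%:R.
Proof.
rewrite -sum_indic; apply: eq_bigr => x _.
by rewrite /f /indic inE; case: (x \in S); rewrite ?mul1r ?mul0r.
Qed.

Lemma sum_indic_shift_le h :
  \sum_x f x * f (x + h) <= (h == 0)%:R * #|S|%:R + C.
Proof.
rewrite sum_indic_shift; have [->|h0] := eqVneq h 0; last by rewrite mul0r add0r hS.
rewrite mul1r -[leLHS]addr0 lerD // ler_nat subset_leq_card //.
by apply/subsetP => x; rewrite inE => /andP[].
Qed.

Lemma wcount_diff z : wcount [:: 1; -1] f z = \sum_x f x * f (x - z).
Proof.
rewrite /=; apply: eq_bigr => x _; congr (_ * _).
rewrite (bigD1 (x - z)) //= big1 => [|y yx].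
  by rewrite addr0 mulrNz mulr1z mul1r mulN1r opprK -(opprB x z) addNr eqxx mulr1.
case: eqP => [h|_]; last by rewrite mulr0.
move: yx; rewrite mulrNz mulr1z mul1r mulN1r opprK in h.
by rewrite -subr_eq0 opprB addrA [y + z]addrC addrAC h eqxx.
Qed.

(** Fix the first two variables: an equal pair leaves at most |S| + C choices for the others, a
    distinct pair at most [C]. *)
Lemma energy_le : wcount [:: 1; -1; 1; -1] f 0 <= (1 + C) * #|S|%:R ^+ 2.
Proof.
have f0 x : 0 <= f x by exact: ler0n.
have -> : wcount [:: 1; -1; 1; -1] f 0 =
    \sum_x \sum_y f x * f y * wcount [:: 1; -1] f (y - x).
  rewrite [LHS]/=; apply: eq_bigr => x _; rewrite mulr_sumr; apply: eq_bigr => y _.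
  rewrite -mulrA; congr (_ * (_ * _)); rewrite -/(wcount [:: 1; -1] f _); congr (wcount _ _ _).
  by rewrite mulrNz mulr1z mul1r mulN1r opprK sub0r addrC.
apply: (@le_trans _ _ (\sum_x \sum_y ((x == y)%:R * f x * #|S|%:R + f x * f y * C))).
  apply: ler_sum => x _; apply: ler_sum => y _; rewrite wcount_diff.
  have := sum_indic_shift_le (- (y - x)); rewrite oppr_eq0 subr_eq0 eq_sym => h.
  apply: (le_trans (ler_wpM2l _ h)); first by rewrite mulr_ge0.
  rewrite mulrDr lerD2r; case: eqP => [->|_]; last by rewrite !mul0r mulr0.
  rewrite !mul1r ler_wpM2r //; rewrite /f /indic; case: (_ \in _); rewrite ?mulr1 ?mulr0 //.
have hx x : \sum_y ((x == y)%:R * f x * #|S|%:R + f x * f y * C) = f x * (#|S|%:R + #|S|%:R * C).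
  rewrite big_split /= -[X in _ + X]mulr_suml -mulr_sumr sum_indic (bigD1 x) //= eqxx mul1r.
  rewrite big1 ?addr0 => [|y yx]; first by ring.
  by rewrite eq_sym (negbTE yx) !mul0r.
under eq_bigr do rewrite hx.
by rewrite -mulr_suml sum_indic le_eqVlt; apply/orP; left; apply/eqP; ring.
Qed.

(** Expanding the square gives the correlations of [f] at d - d'. The diagonal yields |S| / |D|, and
    the bound on differences yields [C] whatever [D] is. *)
Lemma sum_avg_sqr (D : {set G}) : D != set0 ->
  \sum_x avg D f x ^+ 2 <= #|S|%:R / #|D|%:R + C.
Proof.
rewrite -card_gt0 => D0; have Dr : 0 < #|D|%:R :> R by rewrite ltr0n.
have -> : \sum_x avg D f x ^+ 2 =
   #|D|%:R^-1 ^+ 2 * \sum_(d in D) \sum_(d' in D) \sum_x f x * f (x + (d - d')).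
  rewrite /avg; under eq_bigr => x _ do rewrite exprMn [X in _ * X]expr2 mulr_suml.
  rewrite -mulr_sumr; congr (_ * _); rewrite exchange_big; apply: eq_bigr => d _.
  under eq_bigr => x _ do rewrite mulr_sumr.
  rewrite exchange_big; apply: eq_bigr => d' _.
  rewrite (reindex_inj (addIr d)); apply: eq_bigr => x _.
  by rewrite addrK addrA.
have -> : #|S|%:R / #|D|%:R + C = #|D|%:R^-1 ^+ 2 * (#|D|%:R * #|S|%:R + #|D|%:R ^+ 2 * C).
  by field; rewrite gt_eqF.
rewrite ler_wpM2l ?exprn_ge0 ?invr_ge0 ?ler0n //.
apply: (@le_trans _ _ (\sum_(d in D) \sum_(d' in D) ((d == d')%:R * #|S|%:R + C))).
  apply: ler_sum => d _; apply: ler_sum => d' _.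
  by have := sum_indic_shift_le (d - d'); rewrite subr_eq0.
have -> : #|D|%:R * #|S|%:R + #|D|%:R ^+ 2 * C = \sum_(d in D) (#|S|%:R + #|D|%:R * C).
  by rewrite sumr_const -mulr_natl; ring.
apply: ler_sum => d dD; rewrite big_split /= sumr_const mulr_natl lerD2r.
rewrite (bigD1 d) //= eqxx mul1r big1 ?addr0 // => d' /andP[_ dd].
by rewrite eq_sym (negbTE dd) mul0r.
Qed.
End FewDifferences.

Lemma sum_avg (R : realType) (G : finComNzRingType) (D : {set G}) (f : G -> R) :
  D != set0 -> \sum_x avg D f x = \sum_x f x.
Proof.
rewrite -card_gt0 => D0; rewrite /avg -mulr_sumr exchange_big /=.
under eq_bigr => d _ do rewrite (reindex_inj (addIr d)) /=.
under eq_bigr => d _ do under eq_bigr => x _ do rewrite addrK.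
by rewrite sumr_const -[X in _ * X]mulr_natl mulrA mulVf ?mul1r // pnatr_eq0 -lt0n.
Qed.

(** Second moment method: points below the threshold carry at most s / 2 of the sum, and the bound
    on the squares forbids a small set to carry the rest. *)
Lemma level_set_dense (R : realType) (T : finType) (F : T -> R) (s K : R) :
  0 < s -> 0 < K -> (0 < #|T|)%N -> (forall x, 0 <= F x) -> \sum_x F x = s ->
  \sum_x F x ^+ 2 <= K * s ^+ 2 / #|T|%:R ->
  (4 * K)^-1 * #|T|%:R <= #|[set x | s / (2 * #|T|%:R) <= F x]|%:R.
Proof.
move=> s0 K0 T0 F0 hF hF2; set N : R := #|T|%:R; set A := [set x | _].
have N0 : 0 < N by rewrite ltr0n.
(* On the level set F <= l F^2 + 1 / (4 l) by completing the square; this [l] makes the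
   second-moment term at most s / 4. *)
pose l := N / (4 * K * s).
have l0 : 0 < l by rewrite divr_gt0 ?mulr_gt0.
have hpt x : F x <= s / (2 * N) + l * F x ^+ 2 + (x \in A)%:R / (4 * l).
  rewrite inE; case: (lerP (s / (2 * N)) (F x)) => h.
    have : 0 <= s / (2 * N) by rewrite divr_ge0 ?mulr_ge0 ?ltW.
    have : F x <= l * F x ^+ 2 + 1 / (4 * l).
      have -> : l * F x ^+ 2 + 1 / (4 * l) = F x + l * (F x - 1 / (2 * l)) ^+ 2.
        by field; rewrite gt_eqF.
      by rewrite lerDl mulr_ge0 ?sqr_ge0 // ltW.
    by rewrite /= -/A; lra.
  by rewrite /= mul0r addr0; apply: ler_wpDr; [rewrite mulr_ge0 ?sqr_ge0 // ltW | exact: ltW].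
have : s <= \sum_x (s / (2 * N) + l * F x ^+ 2 + (x \in A)%:R / (4 * l)).
  by rewrite -{1}hF; apply: ler_sum => x _.
rewrite !big_split /= sumr_const -mulr_sumr -mulr_suml.
have -> : \sum_i (i \in A)%:R = #|A|%:R :> R.
  by rewrite -sum1_card natr_sum [RHS]big_mkcond; apply: eq_bigr => x _; case: (_ \in A).
rewrite -[X in X + _ + _]mulr_natr -/N => h.
have h1 : s / (2 * N) * N = s / 2 by field; rewrite gt_eqF.
have h2 : l * \sum_x F x ^+ 2 <= s / 4.
  have -> : s / 4 = l * (K * s ^+ 2 / N) by rewrite /l; field; rewrite !gt_eqF.
  by rewrite ler_wpM2l // ltW.
have h3 : s / 4 <= #|A|%:R / (4 * l) by lra.
have h4 : s * l = (4 * K)^-1 * N by rewrite /l; field; rewrite !gt_eqF.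
have l40 : 0 < 4 * l by exact: mulr_gt0.
rewrite (ler_pdivlMr _ _ l40) in h3.
by rewrite -h4; lra.
Qed.

Lemma exists_char (R : realType) (n : nat) : exists e : 'I_n.+2 -> R[i],
  [/\ forall x y, e (x + y) = e x * e y, forall x, nm (e x) = 1 & forall x, e x = 1 -> x = 0].
Proof.
have [z hz] := @prim_root_exists R[i] n.+2 isT.
exists (fun x => z ^+ x); split.
- by move=> x y; rewrite -exprD /= (prim_expr_mod hz).
- have z1 : nm z = 1.
    have : nm z ^+ n.+2 = 1.
      rewrite -(nm1 R) -(prim_expr_order hz).
      by elim: (n.+2) => [|m IH]; rewrite ?expr0 ?nm1 // !exprS nmM IH.
    by move/eqP; rewrite pexpr_eq1 ?nm_ge0 // => /eqP.
  by move=> x; elim: (nat_of_ord x) => [|m IH]; rewrite ?expr0 ?nm1 // exprS nmM z1 IH mulr1.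
- move=> x /eqP; rewrite -(prim_order_dvd hz) => h; apply: val_inj => /=.
  by apply/eqP; rewrite -leqn0 leqNgt; apply/negP => x0; have := dvdn_leq x0 h; rewrite leqNgt ltn_ord.
Qed.

Lemma avg_ge0 (R : realType) (G : finComNzRingType) (D : {set G}) (f : G -> R) x :
  (forall x, 0 <= f x) -> 0 <= avg D f x.
Proof. by move=> f0; rewrite mulr_ge0 ?invr_ge0 // sumr_ge0. Qed.

(* Outside a set of boundedly many frequencies [f] has small Fourier transform,
   and on that set the characters are nearly constant on a set of positive density. *)
Lemma regularizing_set (R : realType) (eta K : R) : 0 < eta ->
  exists M : nat, forall n (e : 'I_n.+2 -> R[i]) (f : 'I_n.+2 -> R),
    (forall x y, e (x + y) = e x * e y) -> (forall x, nm (e x) = 1) ->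
    (forall x, e x = 1 -> x = 0) -> 0 < \sum_x f x ->
    n.+2%:R * wcount [:: 1; -1; 1; -1] f 0 <= K * (\sum_x f x) ^+ 4 ->
    exists D : {set 'I_n.+2}, (n.+2 <= M * #|D|)%N /\
      forall r, 2 * nm (ft e f r) <= eta * (\sum_x f x) \/
        forall d, d \in D -> nm (1 - e (r * d)) <= eta.
Proof.
move=> eta0; have [c hc] := common_almost_period eta0.
have [m hm] := archi (16 * K / eta ^+ 4).
(* The base [c.+1] is positive, so the exponent [#|Q|] may be raised to its bound [m]. *)
exists (c.+1 ^ m)%N => n e f eD e1 eI; set b := \sum_x f x; set E := wcount _ _ _ => b0 hE.
pose Q := [set r | eta * b < 2 * nm (ft e f r)].
have [D [hD hDe]] := hc _ e eD e1 (enum Q).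
(* Each large frequency contributes at least (eta b / 2)^4 to the fourth moment, which is at most K
   b^4. *)
have hQ : (#|Q| <= m)%N.
  rewrite -(ler_nat R); apply: le_trans hm; rewrite ler_pdivlMr ?exprn_gt0 //.
  have h1 : #|Q|%:R * (eta * b) ^+ 4 <= 16 * (n.+2%:R * E).
    have -> : n.+2%:R * E = \sum_r nm (ft e f r) ^+ 4.
      by rewrite (ft_energy eD e1 eI) card_ord.
    rewrite [leRHS]mulr_sumr [leLHS]mulr_natl -sumr_const [leLHS]big_mkcond; apply: ler_sum => r _.
    rewrite inE; case: ltP => h; last by rewrite mulr_ge0 ?exprn_ge0 ?nm_ge0.
    have -> : 16 * nm (ft e f r) ^+ 4 = (2 * nm (ft e f r)) ^+ 4 by ring.
    by apply: lerXn2r; rewrite ?nnegrE ?(ltW h) ?mulr_ge0 ?nm_ge0 ?ltW.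
  have b4 : 0 < b ^+ 4 by rewrite exprn_gt0.
  rewrite -(ler_pM2r b4) -mulrA -exprMn; apply: (le_trans h1).
  by rewrite -mulrA ler_pM2l.
exists D; split.
  rewrite card_ord in hD; apply: (leq_trans hD); rewrite leq_mul2r -cardE.
  apply/orP; right; apply: (@leq_trans (c.+1 ^ #|Q|)).
    by case: (#|Q|) => // q; rewrite leq_exp2r // leqnSn.
  exact: leq_pexp2l.
move=> r; case: (boolP (r \in Q)) => hr.
  by right=> d dD; apply: hDe => //; rewrite mem_enum.
by left; move: hr; rewrite inE -leNgt.
Qed.

(** The density of the level set of the average does not involve [D]. Hence [c0] can be fixed first,
    then [eta] from [c0], and only then [M] and [D] from [eta]. *)
Lemma sparse_count (R : realType) (L : nat) (s : seq int) (B C : R) :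
  (5 <= size s)%N -> all (fun a : int => (a != 0) && (`|a| <= L)%N) s ->
  0 < B -> 0 < C -> dense_count R L s ->
  exists2 c : R, 0 < c & exists s0 : R, forall n (S : {set 'I_n.+2}),
    small_units L n -> s0 <= #|S|%:R -> (0 < #|S|)%N -> n.+2%:R <= B * #|S|%:R ^+ 2 ->
    (forall h, h != 0 -> #|[set y in S | y + h \in S]|%:R <= C) ->
    c * #|S|%:R ^+ size s / n.+2%:R <= wcount s (indic R S) 0.
Proof.
move=> sz hs B0 C0 hdense; set k := size s.
have k0 : 0 < k%:R :> R by rewrite ltr0n; move: sz; rewrite -/k; clear; lia.
pose K2 := 1 + C * B.
have K20 : 0 < K2 by rewrite addr_gt0 ?mulr_gt0.
have [c0 c00 hc0] := hdense (4 * K2)^-1 ltac:(by rewrite invr_gt0 mulr_gt0).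
have C10 : 0 < 1 + C by rewrite addr_gt0.
(* This [eta] makes the bound on the replacement error half of the main term. *)
have [eta [eta0 heta]] : exists eta : R,
    0 < eta /\ c0 = eta * (2 ^+ k.+1 * k%:R ^+ 2 * (1 + C) * B).
  have h0 : 0 < 2 ^+ k.+1 * k%:R ^+ 2 * (1 + C) * B by rewrite !mulr_gt0 ?exprn_gt0.
  by exists (c0 / (2 ^+ k.+1 * k%:R ^+ 2 * (1 + C) * B)); rewrite divr_gt0 ?divfK ?gt_eqF.
have [M hM] := regularizing_set ((1 + C) * B) eta0.
exists (c0 / 2 ^+ k.+1); first by rewrite divr_gt0 ?exprn_gt0.
(* With N the modulus, N <= M |D| <= |S| |D| once |S| >= M, so the diagonal term |S| / |D| is at
   most |S|^2 / N. *)
exists M%:R => n S hu hMS S0 hN hdiff.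
have [N eN] : exists N : R, N = n.+2%:R by exists n.+2%:R.
rewrite -eN in hN *; set b : R := #|S|%:R in hN hMS *.
have N0 : 0 < N by rewrite eN ltr0n.
have b0 : 0 < b by rewrite ltr0n.
have f0 x : 0 <= indic R S x by exact: ler0n.
have hE := energy_le (ltW C0) hdiff.
have hsum : \sum_x indic R S x = b := sum_indic R S.
have [e [eD e1 eI]] := exists_char R n.
have [D [hD hDe]] : exists D : {set 'I_n.+2}, (n.+2 <= M * #|D|)%N /\
      forall r, 2 * nm (ft e (indic R S) r) <= eta * (\sum_x indic R S x) \/
        forall d, d \in D -> nm (1 - e (r * d)) <= eta.
  apply: hM => //; rewrite hsum //.
  apply: (@le_trans _ _ (B * b ^+ 2 * ((1 + C) * b ^+ 2))).
    by rewrite -eN ler_pM ?(ltW N0) // wcount_ge0.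
  by rewrite le_eqVlt; apply/orP; left; apply/eqP; ring.
have D0 : D != set0 by rewrite -card_gt0 lt0n; apply: contraL hD => /eqP->; rewrite muln0.
have Dr : 0 < #|D|%:R :> R by rewrite ltr0n card_gt0.
have hus : all (fun a : int => (a%:~R : 'I_n.+2) \is a GRing.unit) s.
  by apply: sub_all hs => a /andP[a0 aL]; exact: hu.
set F := avg D (indic R S).
have F0 x : 0 <= F x by exact: avg_ge0.
have hclose := wcount_avg_close eD e1 eI sz hus f0 D0 (ltW eta0) hDe.
have hF2 : \sum_x F x ^+ 2 <= K2 * b ^+ 2 / #|'I_n.+2|%:R.
  apply: (le_trans (sum_avg_sqr (ltW C0) hdiff D0)); rewrite card_ord -eN -/b.
  have -> : K2 * b ^+ 2 / N = b ^+ 2 / N + C * (B * b ^+ 2 / N).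
    by rewrite /K2; ring.
  apply: lerD.
    rewrite ler_pdivrMr // mulrAC ler_pdivlMr // expr2 -mulrA ler_pM2l //.
    apply: (@le_trans _ _ (M%:R * #|D|%:R)); first by rewrite eN -natrM ler_nat.
    by rewrite ler_wpM2r.
  by rewrite -[leLHS]mulr1 ler_pM2l // ler_pdivlMr // mul1r.
have hsumF : \sum_x F x = b by rewrite sum_avg.
have := @level_set_dense R _ F b K2 b0 K20 _ F0 hsumF hF2.
rewrite card_ord -eN => /(_ isT); set A := [set x | _] => hA.
(* [F] dominates b / (2 N) times the indicator of [A], and the count is homogeneous of degree
   [k]. *)
have hmain : c0 / 2 ^+ k * b ^+ k / N <= wcount s F 0.
  apply: (@le_trans _ _ (wcount s (fun x => b / (2 * N) * indic R A x) 0)); last first.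
    have bN : 0 <= b / (2 * N) by rewrite divr_ge0 ?mulr_ge0 ?ltW.
    apply: wcount_le => x; first by rewrite mulr_ge0.
    by rewrite /indic inE; case: (lerP (b / (2 * N)) (F x)) => h; rewrite ?mulr1 ?mulr0.
  rewrite wcount_scale -/k.
  have := hc0 n A hu; rewrite -eN -/k => /(_ hA) h.
  have bk : 0 <= (b / (2 * N)) ^+ k by rewrite exprn_ge0 // divr_ge0 ?mulr_ge0 ?ltW.
  apply: le_trans (ler_wpM2l bk h).
  have ek : k = k.-1.+1 by rewrite prednK //; move: sz; rewrite -/k; clear; lia.
  rewrite le_eqVlt; apply/orP; left; apply/eqP; rewrite expr_div_n exprMn.
  have -> : N ^+ k = N * N ^+ k.-1 by rewrite {1}ek exprS.
  have u0 : (2 : R) ^+ k != 0 by rewrite expf_neq0 // pnatr_eq0.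
  have v0 : N ^+ k.-1 != 0 by rewrite expf_neq0 // (gt_eqF N0).
  have w0 : N != 0 by rewrite (gt_eqF N0).
  move: (2 ^+ k) (N ^+ k.-1) u0 v0 => u v u0 v0.
  by field; rewrite u0 v0 w0.
have herr : k%:R ^+ 2 * eta * b ^+ (k - 4) * wcount [:: 1; -1; 1; -1] (indic R S) 0
   <= c0 / 2 ^+ k.+1 * b ^+ k / N.
  apply: (@le_trans _ _ (k%:R ^+ 2 * eta * b ^+ (k - 4) * ((1 + C) * b ^+ 2))).
    by rewrite ler_wpM2l // !mulr_ge0 ?exprn_ge0 ?ltW.
  have ek : b ^+ k = b ^+ (k - 4) * b ^+ 4.
    by rewrite -exprD; congr (b ^+ _); move: sz; rewrite -/k; clear; lia.
  rewrite ler_pdivlMr //.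
  apply: (@le_trans _ _ (k%:R ^+ 2 * eta * b ^+ (k - 4) * ((1 + C) * b ^+ 2) * (B * b ^+ 2))).
    by rewrite ler_wpM2l // !mulr_ge0 ?exprn_ge0 ?ltW.
  rewrite le_eqVlt; apply/orP; left; apply/eqP; rewrite ek heta.
  have u0 : (2 : R) ^+ k.+1 != 0 by rewrite expf_neq0 // pnatr_eq0.
  by move: (2 ^+ k.+1) u0 => u u0; field; rewrite ?u0.
rewrite hsum in hclose.
have hclose2 := le_trans hclose herr.
have hk : c0 / 2 ^+ k * b ^+ k / N = c0 / 2 ^+ k.+1 * b ^+ k / N + c0 / 2 ^+ k.+1 * b ^+ k / N.
  have u0 : (2 : R) ^+ k != 0 by rewrite expf_neq0 // pnatr_eq0.
  have w0 : N != 0 by rewrite (gt_eqF N0).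
  by rewrite exprS; move: (2 ^+ k) u0 => u u0; field; rewrite u0 w0.
move: hclose2; rewrite ler_norml => /andP[h1 _].
rewrite hk in hmain; rewrite -/F in h1.
move: h1 hmain; set x := _ / N; set y := wcount _ _ _; set z := wcount _ _ _.
by clear; lra.
Qed.

Local Close Scope complex_scope.

(** * From residues to integers *)

Lemma dense_count_perm (K : realType) L (s s' : seq int) :
  perm_eq s s' -> dense_count K L s -> dense_count K L s'.
Proof.
move=> h hs alpha a0; have [c c0 hc] := hs alpha a0; exists c => // n A hu hA.
have [e [eD e1 eI]] := exists_char K n.
by rewrite -(wcount_perm eD e1 eI _ _ h) -(perm_size h); exact: hc.
Qed.

(** Sort the coefficients in decreasing order; the head is positive, since otherwise all of them
    would be negative and could not sum to 0. *)
Lemma dense_count_zero_sum (K : realType) (s : seq int) : s != [::] ->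
  all (fun x : int => x != 0) s -> \sum_(x <- s) x = 0 ->
  dense_count K (\sum_(x <- s) `|x|%N)%N s.
Proof.
move=> s0 hs hsum; pose r := fun x y : int => y <= x.
have hp : perm_eq (sort r s) s by rewrite perm_sort.
have rtot : total r by move=> x y; rewrite /r le_total.
have rtr : transitive r by move=> y x z xy yz; exact: le_trans yz xy.
apply: (dense_count_perm hp); rewrite -(perm_big _ hp) /=.
have := sort_sorted rtot s; have : all (fun x : int => x != 0) (sort r s) by rewrite (perm_all _ hp).
have : \sum_(x <- sort r s) x = 0 by rewrite (perm_big _ hp).
have : sort r s != [::] by rewrite -size_eq0 size_sort size_eq0.
case: (sort r s) => // a t _; rewrite !big_cons => hat /andP[a0 ht] /= hsort.
apply: dense_count_sorted => //; last exact: path_sorted hsort.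
rewrite ltNge le_eqVlt negb_or a0 /=; apply/negP => aneg.
have : a + \sum_(x <- t) x < 0.
  rewrite -[ltRHS]addr0 ltr_leD // big_seq; apply: sumr_le0 => x xt.
  by apply: ltW; apply: le_lt_trans aneg; exact: (allP (order_path_min rtr hsort)).
by rewrite hat ltxx.
Qed.

(** Both sides are compared after Fourier inversion, where the product of sums expands into one sum
    over all functions. *)
Lemma wcount_solutions (R : realType) (G : finComNzRingType) (e : G -> R[i])
    (T : finType) (phi : T -> G) (k : nat) (a : 'I_k -> int) :
  (forall x y, e (x + y) = e x * e y) -> (forall x, nm (e x) = 1) ->
  (forall x, e x = 1 -> x = 0) -> injective phi ->
  wcount [seq a i | i <- enum 'I_k] (indic R [set phi x | x in T]) 0 =
    #|[set x : {ffun 'I_k -> T} | \sum_(i < k) (a i)%:~R * phi (x i) == 0]|%:R.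
Proof.
move=> eD e1 eI phiI; set X := [set x : {ffun _ -> _} | _].
have N0 : #|G|%:R != 0 :> R by rewrite pnatr_eq0 -lt0n; apply/card_gt0P; exists 0.
have hft r : ft e (indic R [set phi x | x in T]) r = \sum_(x : T) e (r * phi x).
  rewrite /ft (bigID (mem [set phi x | x in T])) /= [X in _ + X]big1 => [|x /negbTE hx].
    rewrite addr0 big_imset /=; last by move=> x y _ _; exact: phiI.
    by apply: eq_bigr => x _; rewrite /indic imset_f // mul1r.
  by rewrite /indic hx mul0r.
apply: (mulfI N0); apply: complexI; rewrite /= (wcount_fourier eD e1 eI).
have hr r : e (- (r * 0)) * \prod_(b <- [seq a i | i <- enum 'I_k])
      ft e (indic R [set phi x | x in T]) (r * b%:~R) =
    \sum_(x : {ffun 'I_k -> T}) e (r * \sum_(i < k) (a i)%:~R * phi (x i)).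
  rewrite mulr0 oppr0 (char0 eD e1) mul1r big_map big_enum /=.
  under eq_bigr do rewrite hft.
  rewrite bigA_distr_bigA; apply: eq_bigr => x _.
  rewrite mulr_sumr; elim/big_rec2: _ => [|i y z _ ->]; first by rewrite (char0 eD e1).
  by rewrite eD mulrA.
rewrite (eq_bigr _ (fun r _ => hr r)) exchange_big /=.
under eq_bigr do rewrite (sum_char eD e1 eI).
rewrite -mulr_suml rmorphM /= !rmorph_nat mulrC; congr (_ * _).
rewrite -sum1_card natr_sum [RHS]big_mkcond; apply: eq_bigr => x _.
by rewrite inE; case: (_ == _).
Qed.

Lemma intr_ord_eq0 n (z : int) : (`|z| < n.+2)%N -> (z%:~R : 'I_n.+2) = 0 -> z = 0.
Proof.
have hnat m : (m < n.+2)%N -> (m%:R : 'I_n.+2) = 0 -> m = 0%N.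
  by move=> hm /(congr1 val); rewrite Zp_nat /= modn_small.
case: z => m; first by move=> hm /(hnat m hm) ->.
by rewrite NegzE mulrNz => hm /eqP; rewrite oppr_eq0 => /eqP /(hnat m.+1 hm).
Qed.

(** Every j with 0 < j <= L divides L! m, hence is coprime to L! m + 1. *)
Lemma small_units_fact L m n : n.+2 = (L`! * m + 1)%N -> small_units L n.
Proof.
move=> hn t t0 tL.
have hu (j : nat) : (0 < j <= L)%N -> (j%:R : 'I_n.+2) \is a GRing.unit.
  move=> /andP[j0 jL]; have := @unitZpE n.+2 j isT; rewrite /= => ->.
  have /dvdnP[q hq] : (j %| L`! * m)%N by rewrite dvdn_mulr // dvdn_fact // j0.
  by rewrite hn hq coprime_sym /coprime gcdnMDl gcdn1.
case: t t0 tL => j j0 jL; first by apply: hu; move: j0 jL; clear; lia.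
by rewrite NegzE mulrNz unitrN; apply: hu; move: jL; clear; lia.
Qed.

Definition residue (m : nat) (S : {fset int}) (x : S) : 'I_m.+2 := (val x)%:~R.

Lemma residue_inj m n (S : {fset int}) : (n < m.+2)%N ->
  (forall x : int, x \in S -> 1 <= x <= n%:Z) -> injective (@residue m S).
Proof.
move=> nm hS x y /eqP; rewrite /residue -subr_eq0 -intrB => /eqP h.
apply: val_inj; apply/eqP; rewrite -subr_eq0; apply/eqP; apply: intr_ord_eq0 h.
have := hS _ (valP x); have := hS _ (valP y); move: (val x) (val y) nm; clear; lia.
Qed.

Lemma card_residues m n (S : {fset int}) : (n < m.+2)%N ->
  (forall x : int, x \in S -> 1 <= x <= n%:Z) ->
  #|[set residue m x | x : S]| = #|` S|.
Proof.
by move=> nm hS; rewrite card_imset; [rewrite cardfE | exact: residue_inj nm hS].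
Qed.

Lemma solutions_residues m n k (a : 'I_k -> int) (S : {fset int}) :
  (forall x : int, x \in S -> 1 <= x <= n%:Z) ->
  ((\sum_(i < k) `|a i|)%N * n < m.+2)%N ->
  [set x : {ffun 'I_k -> S} | \sum_(i < k) (a i)%:~R * residue m (x i) == 0] = solutions a S.
Proof.
move=> hS hm; apply/setP => x; rewrite !inE.
have -> : \sum_(i < k) (a i)%:~R * residue m (x i) = (\sum_(i < k) a i * val (x i))%:~R.
  by rewrite rmorph_sum; apply: eq_bigr => i _; rewrite /= intrM.
apply/eqP/eqP => [|->]; last by [].
apply: intr_ord_eq0; apply: leq_ltn_trans hm.
rewrite -lez_nat abszE PoszM (big_morph Posz PoszD (erefl _)).
apply: (le_trans (ler_norm_sum _ _ _)).
rewrite mulr_suml; apply: ler_sum => i _; rewrite normrM abszE ler_wpM2l //.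
by have := hS _ (valP (x i)); clear; lia.
Qed.

(** Fix one representation of [h] by integers at distance [d]. Any other one has a distance
    congruent to [d] that differs from it by less than 2 n, so it is also at distance [d]. *)
Lemma residue_differences (K : realType) (C : K) m n (S : {fset int}) : 0 <= C ->
  (2 * n < m.+2)%N -> (forall x : int, x \in S -> 1 <= x <= n%:Z) ->
  (forall h : int, h != 0 -> #|` pairs_at_distance S h|%:R <= C) ->
  forall h : 'I_m.+2, h != 0 ->
  #|[set y in [set residue m x | x : S] | y + h \in [set residue m x | x : S]]|%:R <= C.
Proof.
move=> C0 hm hS hC h h0; set X := [set residue m x | x : S].
have [->|/set0Pn[y0]] := eqVneq [set y in X | y + h \in X] set0; first by rewrite cards0.
rewrite inE => /andP[/imsetP[x0 _ e0]]; rewrite e0 => /imsetP[x1 _ e1].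
pose d := val x1 - val x0.
have dh : d%:~R = h by rewrite intrB -/(residue m x1) -e1 addrC addKr.
have d0 : d != 0 by apply: contraNneq h0 => d0; rewrite -dh d0.
apply: le_trans (hC d d0); rewrite ler_nat.
apply: (@leq_trans #|[set y in [seq (z%:~R : 'I_m.+2) | z <- enum_fset (pairs_at_distance S d)]]|).
  apply: subset_leq_card; apply/subsetP => y; rewrite !inE => /andP[/imsetP[x _ ->] /imsetP[x' _ ex]].
  apply/mapP; exists (val x) => //; rewrite !inE /=; apply/andP; split; first exact: valP.
  suff -> : val x + d = val x' by exact: valP.
  apply/eqP; rewrite -subr_eq0; apply/eqP.
  apply: (@intr_ord_eq0 m); last by rewrite intrB intrD dh -/(residue m x) ex subrr.
  have := hS _ (valP x); have := hS _ (valP x'); have := hS _ (valP x0); have := hS _ (valP x1).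
  by rewrite /d; move: (val x) (val x') (val x0) (val x1) hm; clear; lia.
by rewrite cardsE (leq_trans (card_size _)) // size_map.
Qed.

Lemma diagonal_solutions k (a : 'I_k -> int) (S : {fset int}) : (0 < k)%N ->
  \sum_(i < k) a i = 0 -> (#|` S| <= #|solutions a S|)%N.
Proof.
move=> k0 ha; pose f (x : S) := [ffun _ : 'I_k => x].
have fI : injective f by move=> x y /ffunP /(_ (Ordinal k0)); rewrite !ffunE.
rewrite cardfE -(card_imset _ fI); apply: subset_leq_card.
apply/subsetP => _ /imsetP[x _ ->]; rewrite inE.
by under eq_bigr do rewrite ffunE; rewrite -mulr_suml ha mul0r.
Qed.

Theorem corollary1p10 (R : realType) (eps C : R) (heps : 0 < eps) (hC : 0 < C)
    (k : nat) (hk : (5 <= k)%N) (a : 'I_k -> int)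
    (ha : forall i : 'I_k, a i != 0) (hsum : \sum_(i < k) a i = 0) :
  exists2 delta : R, 0 < delta &
    forall (n : nat) (S : {fset int}),
      (1 <= n)%N ->
      (forall x : int, x \in S -> 1 <= x <= n%:Z) ->
      eps * Num.sqrt (n%:R : R) <= #|` S|%:R ->
      (forall h : int, h != 0 -> #|` pairs_at_distance S h|%:R <= C) ->
      delta * #|` S|%:R ^+ k / n%:R <= #|solutions a S|%:R.
Proof.
pose s := [seq a i | i <- enum 'I_k].
have szs : size s = k by rewrite size_map size_enum_ord.
have k0 : (0 < k)%N by exact: leq_trans hk.
have sn : s != [::] by rewrite -size_eq0 szs -lt0n.
pose L := (\sum_(i < k) `|a i|)%N.
have Ls : (\sum_(x <- s) `|x|%N)%N = L by rewrite big_map big_enum.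
have kL : (k <= L)%N.
  rewrite -[leqLHS]card_ord -sum1_card; apply: leq_sum => i _.
  by rewrite absz_gt0.
have hs0 : all (fun x : int => x != 0) s by apply/allP => _ /mapP[i _ ->].
have hsL : all (fun x : int => (x != 0) && (`|x| <= L)%N) s.
  apply/allP => x xs; rewrite (allP hs0 x xs) /= -Ls (big_rem x xs) /= leq_addr //.
have hdense : dense_count R L s.
  by rewrite -Ls; apply: dense_count_zero_sum => //; rewrite big_map big_enum.
(* The modulus L! n + 1 is at most Q n, and n <= (|S| / eps)^2. *)
pose Q : R := (L`! + 1)%:R.
have Q0 : 0 < Q by rewrite ltr0n addn1.
have B0 : 0 < Q / eps ^+ 2 by rewrite divr_gt0 ?exprn_gt0.
have sz5 : (5 <= size s)%N by rewrite szs.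
have [c c0 [s0 hc]] := sparse_count sz5 hsL B0 hC hdense.
pose t := Num.max s0 1.
have t0 : 0 < t by rewrite lt_max ltr01 orbT.
exists (Num.min (c / Q) (t ^+ k.-1)^-1).
  by rewrite lt_min divr_gt0 ?invr_gt0 ?exprn_gt0.
move=> n S n1 hS hSn hdiff; set b : R := #|` S|%:R.
have n0 : 0 < n%:R :> R by rewrite ltr0n.
have b0 : 0 < b by apply: lt_le_trans hSn; rewrite mulr_gt0 // sqrtr_gt0.
have hb2 : eps ^+ 2 * n%:R <= b ^+ 2.
  rewrite -[X in _ * X](sqr_sqrtr (ltW n0)) -exprMn lerXn2r // nnegrE ?mulr_ge0 ?sqrtr_ge0 ?ltW //.
have bk0 : 0 <= b ^+ k / n%:R by rewrite divr_ge0 ?exprn_ge0 ?ltW.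
have hdiag : b <= #|solutions a S|%:R by rewrite ler_nat diagonal_solutions.
rewrite -mulrA.
(* For b < t the diagonal solutions suffice, because b >= b^k / t^(k-1) and n >= 1. *)
have [hsmall|hbig] := ltP b t.
  apply: le_trans hdiag.
  apply: (@le_trans _ _ ((t ^+ k.-1)^-1 * (b ^+ k / n%:R))).
    by rewrite ler_wpM2r // ge_min lexx orbT.
  rewrite mulrC ler_pdivrMr ?exprn_gt0 // ler_pdivrMr //.
  rewrite -[in X in X <= _](prednK k0) exprS -mulrA ler_pM2l //.
  rewrite -[leLHS]mulr1 ler_pM ?exprn_ge0 ?ler1n ?(ltW b0) //.
  by rewrite lerXn2r ?nnegrE ?ltW.
(* Since L! >= L >= k >= 5, the modulus exceeds 2 n and differences of elements of [S] do not wrap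
   around. *)
have L2 : (2 <= L`!)%N.
  by apply: (@leq_trans L); [exact: leq_trans (leq_trans _ hk) kL | exact: fact_geq].
have [m hm] : exists m, m.+2 = (L`! * n + 1)%N.
  by exists (L`! * n - 1)%N; move: L2 n1; clear; nia.
have hL : (L * n < m.+2)%N by rewrite hm addn1 ltnS leq_mul2r fact_geq orbT.
have h2n : (2 * n < m.+2)%N by rewrite hm addn1 ltnS leq_mul2r L2 orbT.
have hn : (n < m.+2)%N by apply: leq_ltn_trans h2n; rewrite leq_pmull.
set X := [set residue m x | x : S].
have cX : #|X| = #|` S| := card_residues hn hS.
have [e [eD e1 eI]] := exists_char R m.
have := hc m X (small_units_fact hm).
have mQ : m.+2%:R <= Q * n%:R :> R.
  by rewrite hm -natrM ler_nat mulnDl mul1n leq_add2l.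
have s0b : s0 <= b by apply: le_trans hbig; rewrite le_max lexx.
have hB : m.+2%:R <= Q / eps ^+ 2 * b ^+ 2.
  by apply: (le_trans mQ); rewrite -mulrA ler_pM2l // ler_pdivlMl ?exprn_gt0.
have S0 : (0 < #|` S|)%N by rewrite -(ltr0n R).
rewrite cX -/b => /(_ s0b S0 hB (residue_differences (ltW hC) h2n hS hdiff)).
rewrite (wcount_solutions a eD e1 eI (residue_inj hn hS)) (solutions_residues hS hL) szs.
apply: le_trans.
apply: (@le_trans _ _ (c / Q * (b ^+ k / n%:R))).
  by rewrite ler_wpM2r // ge_min lexx.
have -> : c / Q * (b ^+ k / n%:R) = c * b ^+ k / (Q * n%:R).
  by rewrite invfM; ring.
by rewrite ler_pM2l ?mulr_gt0 ?exprn_gt0 // lef_pV2 // posrE ?mulr_gt0.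
Qed.
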